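(* Let $1\le r\le n$, let $V\in\mathbb{R}^{n\times r}_*$ be a solution of the problem of maximizing $\mathcal{I}(V^TY,X)$ over $V\in\mathbb{R}^{n\times r}_*$, let $W=V^TY$, and let $(\lambda_i)_{i=1}^n$ be the eigenvalues, sorted in decreasing order, of the generalized eigenvalue problem $C_Yv=\lambda C_Ev$, $\lambda\in\mathbb{R}$, $v\in\mathbb{R}^n$. Assume $\mathcal{I}(Y,X)\ne0$. Then the relative error on the mutual information is given by $$\frac{\mathcal{I}(Y,X)-\mathcal{I}(W,X)}{\mathcal{I}(Y,X)}=1-\frac{\sum_{i=1}^r\log\lambda_i}{\sum_{i=1}^n\log\lambda_i}.$$
   Context: Linear Gaussian model: $Y=BX+E$ with $B\in\mathbb{R}^{n\times q}$ deterministic, $X\sim\mathcal{N}(m_X,C_X)$ in $\mathbb{R}^q$ and $E\sim\mathcal{N}(m_E,C_E)$ in $\mathbb{R}^n$ independent, $C_X$ and $C_E$ symmetric positive definite. $C_Y=BC_XB^T+C_E$ is the covariance of $Y$. $\mathbb{R}^{n\times r}_*$ is the set of full-rank matrices in $\mathbb{R}^{n\times r}$. Eigenvalues are counted with multiplicity. The (differential) entropy of a random vector $Z$ with density $f_Z$ is $H(Z)=\mathbb{E}_Z(-\log f_Z(Z))$, and the mutual information is $\mathcal{I}(Z_0,Z_1)=H(Z_0)+H(Z_1)-H(Z_0,Z_1)$, where $H(Z_0,Z_1)$ is the entropy of the joint distribution of $(Z_0,Z_1)$. *)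

(* Defs.v *)
From HB Require Import structures.
From mathcomp Require Import all_boot all_order all_algebra.
From mathcomp Require Import all_classical all_reals all_analysis.

Set Implicit Arguments.
Unset Strict Implicit.
Unset Printing Implicit Defensive.

Import Order.TTheory GRing.Theory Num.Theory.
Import numFieldNormedType.Exports.

Local Open Scope classical_set_scope.
Local Open Scope ring_scope.

(* The product (= Borel) sigma-algebra on column vectors. *)
Definition cV_display : measure_display. Proof. exact: default_measure_display. Qed.

Section cV_measurable.
Context {R : realType} (n : nat).

Definition cV_coor (i : 'I_n) (x : 'cV[R]_n) : measurableTypeR R := x i 0.

Let cV_set0 : g_sigma_preimage cV_coor set0.
Proof. exact: sigma_algebra0. Qed.

Let cV_setC A : g_sigma_preimage cV_coor A -> g_sigma_preimage cV_coor (~` A).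
Proof. exact: sigma_algebraC. Qed.

Let cV_bigcup (F : _^nat) : (forall i, g_sigma_preimage cV_coor (F i)) ->
  g_sigma_preimage cV_coor (\bigcup_i (F i)).
Proof. exact: sigma_algebra_bigcup. Qed.

HB.instance Definition _ := @isMeasurable.Build cV_display
  'M[R]_(n, 1) (g_sigma_preimage cV_coor) cV_set0 cV_setC cV_bigcup.

End cV_measurable.

Lemma measurable_cV_coor (R : realType) n (i : 'I_n) :
  measurable_fun [set: 'cV[R]_n] (cV_coor i).
Proof.
move=> _ Y mY; rewrite setTI; apply: sub_sigma_algebra => /=.
rewrite -bigcup_seq/=; exists i => /=; first by rewrite mem_index_enum.
by exists Y => //; rewrite setTI.
Qed.

Lemma measurable_fun_cVP d (T : measurableType d) (R : realType) n
    (f : T -> 'cV[R]_n) :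
  measurable_fun [set: T] f <->
  forall i, measurable_fun [set: T] (cV_coor i \o f).
Proof.
split=> [mf i|mf].
  by apply: measurableT_comp => //; exact: measurable_cV_coor.
move=> _ A mA; rewrite setTI; move: A mA.
suff : g_sigma_preimage (@cV_coor R n) `<=` [set A | measurable (f @^-1` A)] by [].
apply: smallest_sub.
  split => /=; first by rewrite preimage_set0.
    by move=> A mA; rewrite setTD preimage_setC; exact: measurableC.
  by move=> F mF; rewrite preimage_bigcup; exact: bigcup_measurable.
move=> A; rewrite -bigcup_seq /= => -[i _ [B mB <-]].
by rewrite setTI -comp_preimage -[X in measurable X]setTI; exact: mf.
Qed.

Section lebesgue_cV.
Context {R : realType}.

Definition cV_cons n (p : measurableTypeR R * 'cV[R]_n) : 'cV[R]_n.+1 :=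
  col_mx (p.1%:M : 'M[R]_1) p.2.

Definition cV_uncons n (x : 'cV[R]_n.+1) : measurableTypeR R * 'cV[R]_n :=
  (x 0 0, \col_i x (lift 0 i) 0).

Lemma cV_cons0 n p : @cV_cons n p 0 0 = p.1.
Proof.
have e : (0 : 'I_n.+1) = lshift n (0 : 'I_1) by exact/val_inj.
rewrite /cV_cons e; apply: (etrans (col_mxEu _ _ _ _)).
by rewrite mxE eqxx mulr1n.
Qed.

Lemma cV_consS n p i : @cV_cons n p (lift 0 i) 0 = p.2 i 0.
Proof.
have e : lift 0 i = rshift 1 i by exact/val_inj.
by rewrite /cV_cons e; exact: col_mxEd.
Qed.

Lemma cV_consK n : cancel (@cV_cons n) (@cV_uncons n).
Proof.
move=> [a v]; rewrite /cV_uncons cV_cons0; congr pair.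
by apply/colP => i; rewrite mxE cV_consS.
Qed.

Lemma cV_unconsK n : cancel (@cV_uncons n) (@cV_cons n).
Proof.
move=> x; apply/colP => i; have [j ->|->] := fintype.unliftP 0 i; last first.
  by rewrite cV_cons0.
by rewrite cV_consS mxE.
Qed.

Lemma measurable_cV_cons n : measurable_fun setT (@cV_cons n).
Proof.
apply/measurable_fun_cVP => i; have [j ->|->] := fintype.unliftP 0 i; last first.
  rewrite (_ : _ \o _ = fst); first exact: measurable_fst.
  by apply/funext => p; rewrite /cV_coor /= cV_cons0.
rewrite (_ : _ \o _ = cV_coor j \o snd).
  apply: measurableT_comp => //; exact: measurable_cV_coor.
by apply/funext => p; rewrite /cV_coor /= cV_consS.
Qed.

Lemma measurable_cV_uncons n : measurable_fun setT (@cV_uncons n).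
Proof.
apply/measurable_fun_pairP; split => /=.
  exact: (@measurable_cV_coor R n.+1 0).
apply/measurable_fun_cVP => i.
rewrite (_ : _ \o _ = cV_coor (lift 0 i)); first exact: measurable_cV_coor.
by apply/funext => x; rewrite /cV_coor /= mxE.
Qed.

Section step.
Variables (n : nat) (mu : {sigma_finite_measure set 'cV[R]_n -> \bar R}).

Definition cV_cons_measure : set 'cV[R]_n.+1 -> \bar R :=
  pushforward (lebesgue_measure \x mu)%E (@cV_cons n).

Let m0 : cV_cons_measure set0 = 0%E.
Proof. by rewrite /cV_cons_measure /pushforward preimage_set0 measure0. Qed.

Let m_ge0 A : (0 <= cV_cons_measure A)%E.
Proof. by rewrite /cV_cons_measure /pushforward; exact: measure_ge0. Qed.

Let m_sigma_additive : semi_sigma_additive cV_cons_measure.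
Proof.
move=> F mF tF mUF; rewrite /cV_cons_measure /pushforward preimage_bigcup.
have mpre A : measurable A -> measurable (@cV_cons n @^-1` A).
  by move=> mA; rewrite -[X in measurable X]setTI; exact: measurable_cV_cons.
apply: measure_semi_sigma_additive.
- by move=> k; exact: mpre.
- apply/trivIsetP => i j _ _ ij; rewrite -preimage_setI.
  by move/trivIsetP : tF => /(_ i j) ->//; rewrite preimage_set0.
- by rewrite -preimage_bigcup; exact: mpre.
Qed.

HB.instance Definition _ := isMeasure.Build _ _ _ cV_cons_measure
  m0 m_ge0 m_sigma_additive.

Let m_sigma_finite : sigma_finite setT cV_cons_measure.
Proof.
have /sigma_finiteP[F [TF ndF Foo]] := sigma_finiteT (@lebesgue_measure R).
have /sigma_finiteP[G [TG ndG Goo]] := sigma_finiteT mu.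
exists (fun k => @cV_uncons n @^-1` (F k `*` G k)).
  rewrite -preimage_bigcup -(preimage_setT (@cV_uncons n)); congr preimage.
  apply/esym/seteqP; split => // -[x y] _.
  have [i _ Fx] : (\bigcup_i F i) x by rewrite -TF.
  have [j _ Gy] : (\bigcup_i G i) y by rewrite -TG.
  exists (maxn i j) => //; split => /=.
    by move: x Fx; exact/subsetPset/ndF/leq_maxl.
  by move: y Gy; exact/subsetPset/ndG/leq_maxr.
move=> k; have [mFk Fkoo] := Foo k; have [mGk Gkoo] := Goo k; split.
  rewrite -[X in measurable X]setTI; apply: measurable_cV_uncons => //.
  exact: measurableX.
rewrite /cV_cons_measure /pushforward -comp_preimage.
rewrite (_ : _ \o _ = id) ?preimage_id; last first.
  by apply/funext => p; exact: cV_consK.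
by rewrite product_measure1E// lte_mul_pinfty// ge0_fin_numE.
Qed.

HB.instance Definition _ := Measure_isSigmaFinite.Build _ _ _ cV_cons_measure
  m_sigma_finite.

End step.

(* Lebesgue measure on R^n, as an iterated product; see [lebesgue_cV_box]. *)
Fixpoint lebesgue_cV n : {sigma_finite_measure set 'cV[R]_n -> \bar R} :=
  match n with
  | 0%N => @dirac _ 'cV[R]_0 0 R
  | n'.+1 => cV_cons_measure (lebesgue_cV n')
  end.

Lemma lebesgue_cV_box n (A : 'I_n -> set (measurableTypeR R)) :
  (forall i, measurable (A i)) ->
  lebesgue_cV n [set x | forall i, A i (x i 0)] =
  (\prod_(i < n) lebesgue_measure (A i))%E.
Proof.
elim: n A => [|n IH] A mA.
  rewrite big_ord0 /= /dirac indicE mem_set//; by case.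
rewrite big_ord_recl /= /cV_cons_measure /pushforward.
rewrite (_ : _ @^-1` _ =
  A 0 `*` [set x : 'cV[R]_n | forall i, A (lift 0 i) (x i 0)]); last first.
  apply/seteqP; split => -[a v] /= H.
    split=> [|i]; first by have := H 0; rewrite cV_cons0.
    by have := H (lift 0 i); rewrite cV_consS.
  move=> i; have [j ->|->] := fintype.unliftP 0 i; last first.
    by rewrite cV_cons0; exact: H.1.
  by rewrite cV_consS; exact: H.2.
rewrite product_measure1E//.
  by congr (_ * _)%E; exact: (IH (fun i => A (lift 0 i))).
rewrite (_ : mkset _ =
    \bigcap_(i in [set: 'I_n]) (cV_coor i @^-1` A (lift 0 i))); last first.
  by apply/seteqP; split => x /= Ax i; [move=> _|]; exact: Ax.
apply: fin_bigcap_measurable => // i _.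
by rewrite -[X in measurable X]setTI; exact: measurable_cV_coor.
Qed.

End lebesgue_cV.

Section entropy.
Context d (T : measurableType d) (R : realType) (P : probability T R).

Definition is_density n (Z : T -> 'cV[R]_n) (f : 'cV[R]_n -> R) : Prop :=
  [/\ measurable_fun setT f, (forall x, 0 <= f x) &
      forall A, measurable A ->
        P (Z @^-1` A) = (\int[lebesgue_cV n]_(x in A) (f x)%:E)%E].

(* A density of Z (unique almost everywhere), or 0 if Z has none. *)
Definition density n (Z : T -> 'cV[R]_n) : 'cV[R]_n -> R :=
  xget (cst 0) [set f | is_density Z f].

Definition entropy n (Z : T -> 'cV[R]_n) : \bar R :=
  'E_P[fun w => - ln (density Z (Z w))].

Definition mutual_information m n (Z0 : T -> 'cV[R]_m) (Z1 : T -> 'cV[R]_n) :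
    \bar R :=
  (entropy Z0 + entropy Z1 - entropy (fun w => col_mx (Z0 w) (Z1 w)))%E.

Definition independent_vectors m n (Z0 : T -> 'cV[R]_m) (Z1 : T -> 'cV[R]_n) :
    Prop :=
  forall A B, measurable A -> measurable B ->
    P (Z0 @^-1` A `&` Z1 @^-1` B) = (P (Z0 @^-1` A) * P (Z1 @^-1` B))%E.

Definition gaussian_pdf n (m : 'cV[R]_n) (C : 'M[R]_n) (x : 'cV[R]_n) : R :=
  expR (- ((x - m)^T *m invmx C *m (x - m)) 0 0 / 2) /
  Num.sqrt ((2 * pi) ^+ n * \det C).

(* Z ~ N(m, C), for a positive definite C. *)
Definition gaussian n (Z : T -> 'cV[R]_n) (m : 'cV[R]_n) (C : 'M[R]_n) : Prop :=
  is_density Z (gaussian_pdf m C).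

End entropy.

Definition sym_posdef (R : realType) n (C : 'M[R]_n) : Prop :=
  C^T = C /\ forall x : 'cV[R]_n, x != 0 -> 0 < (x^T *m C *m x) 0 0.

Definition full_rank (R : fieldType) n r (V : 'M[R]_(n, r)) : Prop :=
  \rank V = minn n r.

(* The rows span (the transposes of) the solutions v of A v = mu B v. *)
Definition gen_eigenspace (R : fieldType) n (A B : 'M[R]_n) (mu : R) : 'M[R]_n :=
  kermx (A - mu *: B)^T.

Lemma gen_eigenspaceP (R : fieldType) n (A B : 'M[R]_n) mu (v : 'cV[R]_n) :
  reflect (A *m v = mu *: (B *m v)) (v^T <= gen_eigenspace A B mu)%MS.
Proof.
apply: (iffP sub_kermxP); rewrite -trmx_mul mulmxBl -scalemxAl => Av.
  by apply/eqP; rewrite -subr_eq0 -trmx_eq0 Av.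
by rewrite Av subrr trmx0.
Qed.

(* [lam] lists every eigenvalue mu of A v = mu B v, each repeated as many times
   as the dimension of its eigenspace, in decreasing order. *)
Definition gen_eigenvalues (R : realType) n (A B : 'M[R]_n) (lam : 'I_n -> R) :
    Prop :=
  (forall i j : 'I_n, (i <= j)%N -> lam j <= lam i) /\
  forall mu : R, #|[pred i | lam i == mu]| = \rank (gen_eigenspace A B mu).

Definition max_information d (T : measurableType d) (R : realType)
    (P : probability T R) n q (Y : T -> 'cV[R]_n) (X : T -> 'cV[R]_q)
    r (V : 'M[R]_(n, r)) : Prop :=
  full_rank V /\
  forall V' : 'M[R]_(n, r), full_rank V' ->
    (mutual_information P (fun w => V'^T *m Y w) X <=
     mutual_information P (fun w => V^T *m Y w) X)%E.

(* Main.v *)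
(** By whitening and the linear change of variables formula, a Gaussian vector
    with covariance [C] in [R^n] has entropy [n * c + ln (\det C) / 2] for a
    universal constant [c].  As [(V^T Y, X)] is a linear image of the Gaussian
    vector [(E, X)], the constants cancel in the mutual information and
    [I(V^T Y, X) = ln (\det (V^T C_Y V) / \det (V^T C_E V)) / 2].  In a
    [C_E]-orthonormal basis of generalized eigenvectors, this ratio of
    determinants is at most the product of the [r] largest eigenvalues (Fischer's
    inequality and the Courant-Fischer dimension count), with equality for the
    span of the first [r] eigenvectors; and [r = n], [V = 1] gives [I(Y, X)]. *)

Require Import Defs.
From HB Require Import structures.
From mathcomp Require Import all_boot all_order all_algebra.
From mathcomp Require Import all_classical all_reals all_analysis.
From mathcomp Require Import measurable_realfun ring.

Set Implicit Arguments.
Unset Strict Implicit.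
Unset Printing Implicit Defensive.

Import Order.TTheory GRing.Theory Num.Theory.
Import numFieldNormedType.Exports.

Local Open Scope classical_set_scope.
Local Open Scope ring_scope.

(** * Positive definite matrices *)

Section posdef.
Context {R : realType}.

(** Working from [(E, X)] keeps covariances simple: independence makes the covariance block
    diagonal, and the map to [(V^T Y, X)] is block triangular with full row rank. The joint
    covariance therefore stays invertible, and its determinant is [\det (V^T C_E V) * \det C_X]: the
    covariance of [V^T Y] given [X], times that of [X]. This is how [C_E] reaches the denominator,
    while [\det C_X] cancels against the entropy of [X].

    Two encodings shape the analytic part. [density] is an arbitrary choice among densities, so
    explicit Gaussian formulas can replace it only after showing that densities agree almost
    everywhere and that the exceptional set has probability 0. Lebesgue measure is built one
    coordinate at a time, so linear changes of variables come from factoring matrices into block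
    triangular ones, each handled by Tonelli.

    About [V] only its maximality is known, so its value is squeezed between an upper bound valid
    for all matrices and a value attained by an explicit one. *)

Lemma posdef_congr m n (C : 'M[R]_n) (A : 'M[R]_(m, n)) :
  sym_posdef C -> row_free A -> sym_posdef (A *m C *m A^T).
Proof.
move=> [Csym Cpos] Afree; split.
  by rewrite !trmx_mul trmxK Csym mulmxA.
move=> x x0; have := Cpos (A^T *m x).
rewrite trmx_mul trmxK !mulmxA; apply.
rewrite -trmx_eq0 trmx_mul trmxK -(mul0mx _ A).
by rewrite (inj_eq (row_free_inj Afree)) trmx_eq0.
Qed.

Lemma posdef_scalar1 n : sym_posdef (1%:M : 'M[R]_n).
Proof.
split=> [|x x0]; first by rewrite trmx1.
rewrite mulmx1 mxE; under eq_bigr do rewrite mxE -expr2.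
rewrite lt0r sumr_ge0 ?andbT; last by move=> i _; rewrite sqr_ge0.
apply: contra x0 => /eqP/psumr_eq0P h; apply/eqP/colP => i; rewrite mxE.
apply/eqP; rewrite -sqrf_eq0; apply/eqP; apply: h => // j _; exact: sqr_ge0.
Qed.

(** Cholesky factorization by induction on Schur complements. It supplies positivity of
    determinants, orthonormalization and whitening. *)
Lemma posdef_cholesky n (C : 'M[R]_n) :
  sym_posdef C -> exists2 A : 'M[R]_n, A \in unitmx & C = A *m A^T.
Proof.
elim: n C => [|n IH] C hC.
  by exists 1%:M; [exact: unitmx1|apply/matrixP => -[]].
move: C hC; rewrite -[n.+1]/(1 + n)%N => C [Csym Cpos].
pose a := (ulsubmx C) 0 0; pose b := dlsubmx C; pose D := drsubmx C.
have CE : C = block_mx a%:M b^T b D.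
  rewrite -[LHS]submxK; congr block_mx; first exact: mx11_scalar.
  by rewrite /b -[in RHS]Csym trmx_dlsub trmxK.
have a0 : 0 < a.
  have := Cpos (col_mx 1%:M 0).
  rewrite CE tr_col_mx mul_row_block mul_row_col !trmx0 trmx1 !mul1mx.
  rewrite !mul0mx mulmx0 !addr0 mulmx1 mxE eqxx mulr1n; apply.
  by rewrite col_mx_eq0 negb_and matrix_nonzero1.
(* [L] eliminates the first column, so [L C L^T] is the Schur complement of [a]; being a congruence
   by a row-free matrix, it is positive definite. *)
pose L := row_mx (- a^-1 *: b) 1%:M : 'M[R]_(n, 1 + n).
have Lfree : row_free L.
  apply/row_freeP; exists (col_mx 0 1%:M).
  by rewrite mul_row_col mulmx0 mulmx1 add0r.
have LCL : L *m C *m L^T = D - a^-1 *: (b *m b^T).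
  rewrite /L CE mul_row_block tr_row_mx mul_row_col trmx1 !mul1mx mulmx1.
  rewrite mul_mx_scalar scalerA mulrN divff ?gt_eqF// scaleN1r addNr mul0mx.
  by rewrite add0r -scalemxAl scaleNr addrC.
have [] := IH (D - a^-1 *: (b *m b^T)).
  by rewrite -LCL; exact: posdef_congr.
move=> A' A'u A'E.
pose s := Num.sqrt a.
have ss : s * s = a by rewrite -expr2 sqr_sqrtr// ltW.
have s0 : s != 0 by rewrite gt_eqF// sqrtr_gt0.
exists (block_mx s%:M 0 (s^-1 *: b) A').
  rewrite unitmxE det_lblock unitrM -!unitmxE A'u andbT.
  by rewrite unitmxE det_scalar1 unitfE.
rewrite CE tr_block_mx mulmx_block tr_scalar_mx trmx0 mul0mx mulmx0.
rewrite !addr0 -scalar_mxM ss; congr block_mx.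
- by rewrite linearZ/= mul_scalar_mx scalerA divff// scale1r mul0mx addr0.
- by rewrite mul_mx_scalar scalerA divff// scale1r.
- rewrite -A'E linearZ/= -scalemxAl -scalemxAr scalerA -invfM ss.
  by rewrite addrC subrK.
Qed.

Lemma posdef_det_gt0 n (C : 'M[R]_n) : sym_posdef C -> 0 < \det C.
Proof.
move=> /posdef_cholesky[A Au ->]; rewrite det_mulmx det_tr -expr2.
by rewrite exprn_even_gt0//= -unitfE -unitmxE.
Qed.

Lemma posdef_unit n (C : 'M[R]_n) : sym_posdef C -> C \in unitmx.
Proof. by move=> /posdef_det_gt0 h; rewrite unitmxE unitfE gt_eqF. Qed.

Lemma posdef_inv n (C : 'M[R]_n) : sym_posdef C -> sym_posdef (invmx C).
Proof.
move=> hC; have Cu := posdef_unit hC.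
have -> : invmx C = invmx C *m C *m (invmx C)^T.
  by rewrite mulVmx// mul1mx trmx_inv hC.1.
by apply: posdef_congr => //; rewrite row_free_unit unitmx_inv.
Qed.

Lemma posdef_block_diag m n (C : 'M[R]_m) (D : 'M[R]_n) :
  sym_posdef C -> sym_posdef D -> sym_posdef (block_mx C 0 0 D).
Proof.
move=> hC hD; have [A Au ->] := posdef_cholesky hC.
have [B Bu ->] := posdef_cholesky hD.
rewrite [X in sym_posdef X](_ : _ =
  block_mx A 0 0 B *m 1%:M *m (block_mx A 0 0 B)^T); last first.
  rewrite mulmx1 tr_block_mx mulmx_block !trmx0 !mulmx0 !mul0mx.
  by rewrite !addr0 !add0r.
apply: posdef_congr; first exact: posdef_scalar1.
by rewrite row_free_unit unitmxE det_ublock unitrM -!unitmxE Au.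
Qed.

Lemma posdef_diag n (d : 'rV[R]_n) :
  (forall i, 0 < d 0 i) -> sym_posdef (diag_mx d).
Proof.
move=> d0; split=> [|x x0]; first by rewrite tr_diag_mx.
have E : (x^T *m diag_mx d *m x) 0 0 = \sum_i d 0 i * x i 0 ^+ 2.
  by rewrite mul_mx_diag mxE; apply: eq_bigr => i _; rewrite !mxE; ring.
have ge0 i : 0 <= d 0 i * x i 0 ^+ 2 by rewrite mulr_ge0 ?sqr_ge0// ltW.
rewrite E lt0r sumr_ge0// andbT.
apply: contra x0 => /eqP/psumr_eq0P h; apply/eqP/colP => i; rewrite mxE.
have /eqP := h (fun i _ => ge0 i) i isT.
by rewrite mulf_eq0 gt_eqF//= sqrf_eq0 => /eqP.
Qed.

(** Eliminating [b] shows that the determinant is [(a - b C^-1 b^T) * \det C], and the subtracted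
    term is nonnegative because [C^-1] is positive definite. *)
Lemma fischer n (a : R) (b : 'M[R]_(1, n)) (C : 'M[R]_n) :
  sym_posdef (block_mx a%:M b b^T C) ->
  \det (block_mx a%:M b b^T C) <= a * \det C.
Proof.
move=> hM; have hC : sym_posdef C.
  rewrite (_ : C = row_mx 0 1%:M *m block_mx a%:M b b^T C *m (row_mx 0 1%:M)^T).
    apply: posdef_congr hM _; apply/row_freeP; exists (col_mx 0 1%:M).
    by rewrite mul_row_col mulmx0 mulmx1 add0r.
  rewrite mul_row_block tr_row_mx mul_row_col trmx0 trmx1 mulmx0 !mul0mx.
  by rewrite !add0r mul1mx mulmx1.
have Cu := posdef_unit hC.
pose s := a%:M - b *m invmx C *m b^T : 'M[R]_1.
have -> : block_mx a%:M b b^T C =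
    block_mx 1%:M (b *m invmx C) 0 1%:M *m block_mx s 0 b^T C.
  rewrite mulmx_block !mul1mx !mul0mx !add0r.
  by rewrite mulmxKV// subrK.
rewrite det_mulmx det_ublock !det1 !mul1r det_lblock.
apply: ler_wpM2r; first by rewrite ltW// posdef_det_gt0.
have -> : \det s = a - (b *m invmx C *m b^T) 0 0.
  by rewrite det_mx11 [in LHS]mxE [X in X + _]mxE [X in _ + X]mxE eqxx mulr1n.
have [->|b0] := eqVneq b 0; first by rewrite !mul0mx mxE subr0.
have iC := posdef_inv hC.
have := iC.2 b^T; rewrite trmx_eq0 trmxK => /(_ b0) h.
by rewrite gerBl ltW.
Qed.

End posdef.

(** * Determinants of compressions and generalized eigenbases *)

Section trace_max.
Context {R : realType}.

Lemma quad_form_gt0 n (v : 'rV[R]_n) : v != 0 -> 0 < (v *m v^T) 0 0.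
Proof.
move=> v0; have := (@posdef_scalar1 R n).2 v^T.
by rewrite trmxK mulmx1 trmx_eq0 => /(_ v0).
Qed.

Lemma prod_prefixS n (lam : 'I_n -> R) r (rn : (r < n)%N) :
  \prod_(i < n | (i < r.+1)%N) lam i =
  lam (Ordinal rn) * \prod_(i < n | (i < r)%N) lam i.
Proof.
rewrite (bigD1 (Ordinal rn))//=; congr (_ * _); apply: eq_bigl => i.
by rewrite -val_eqE/= ltnS ltn_neqAle andbC.
Qed.

Lemma exists_vanishing_prefix r n (S : 'M[R]_(1 + r, n)) :
  exists2 w : 'rV[R]_(1 + r), w != 0 &
    forall j : 'I_n, (j < r)%N -> (w *m S) 0 j = 0.
Proof.
(* [r] homogeneous equations in [1 + r] unknowns. Columns [k >= n] do not exist in [S]; [insub]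
   fills them with 0, which adds only trivial equations. *)
pose N := \matrix_(i < 1 + r, k < r)
  (if insub (k : nat) is Some j then S i j else 0).
have /rowV0Pn[w /sub_kermxP wN w0] : kermx N != 0.
  by rewrite -mxrank_eq0 mxrank_ker -lt0n subn_gt0 ltnS rank_leq_col.
exists w => // j jr.
have := congr1 (fun M : 'rV[R]_r => M 0 (Ordinal jr)) wN.
rewrite [RHS]mxE => <-; rewrite !mxE; apply: eq_bigr => i _; rewrite mxE/=.
by rewrite valK.
Qed.

Lemma exists_ker_basis k r (u : 'M[R]_(k + r, k)) : \rank u = k ->
  exists2 K : 'M[R]_(r, k + r), row_free K & K *m u = 0.
Proof.
move=> ru; have rk : \rank (kermx u) = r by rewrite mxrank_ker ru addKn.
have : (row_base (kermx u) *m u == 0).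
  by apply/eqP/sub_kermxP; rewrite eq_row_base.
(* The basis is generalized because its number of rows is the term [\rank (kermx u)], which can then
   be rewritten to [r] in its type. *)
move: (row_base _) (row_base_free (kermx u)); rewrite rk => K Kf /eqP Ku.
by exists K.
Qed.

Lemma diag_quad_le n (lam : 'I_n -> R) (r : 'I_n) (v : 'rV[R]_n) :
  (forall i j : 'I_n, (i <= j)%N -> lam j <= lam i) ->
  (forall j : 'I_n, (j < r)%N -> v 0 j = 0) ->
  (v *m diag_mx (\row_i lam i) *m v^T) 0 0 <= lam r * (v *m v^T) 0 0.
Proof.
move=> lam_dec v0; rewrite mul_mx_diag !mxE mulr_sumr; apply: ler_sum => i _.
rewrite !mxE mulrAC mulrC; have [/v0 ->|ri] := ltnP i r.
  by rewrite !(mul0r, mulr0).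
by rewrite ler_wpM2r ?lam_dec// -expr2 sqr_ge0.
Qed.

(* A vector of the row space of [S] orthogonal to the first [r - 1] axes has
   Rayleigh quotient at most [lam_r]; splitting it off orthogonally, Fischer's
   inequality reduces the rank by one. *)
Lemma det_compression_le n r (lam : 'I_n -> R) (S : 'M[R]_(r, n)) :
  (forall i, 0 < lam i) ->
  (forall i j : 'I_n, (i <= j)%N -> lam j <= lam i) ->
  row_free S ->
  \det (S *m diag_mx (\row_i lam i) *m S^T) <=
  \prod_(i < n | (i < r)%N) lam i * \det (S *m S^T).
Proof.
move=> lam0 lam_dec; elim: r S => [|r IH] S Sf.
  by rewrite big_pred0// !det_mx00 mulr1.
move: S Sf; rewrite -[r.+1]/(1 + r)%N => S Sf.
set D := diag_mx _; have hD : sym_posdef D.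
  by apply: posdef_diag => i; rewrite mxE.
have rn : (r < n)%N by move/eqP: Sf => e; rewrite -add1n -e rank_leq_col.
have [w w0 wS] := exists_vanishing_prefix S.
set v := w *m S in wS.
have v0 : v != 0.
  by rewrite -(mul0mx _ S) (inj_eq (row_free_inj Sf)).
have : S *m v^T != 0.
  apply: contraL (quad_form_gt0 v0) => /eqP e.
  by rewrite {1}/v -mulmxA e mulmx0 mxE ltxx.
(* The rows of [K S] span the orthogonal complement of [v] inside the row space of [S]. *)
move=> u0; have /exists_ker_basis[K Kf Ku] : \rank (S *m v^T) = 1%N.
  by apply/eqP; rewrite eqn_leq rank_leq_col lt0n mxrank_eq0.
set M := K *m S.
have Mf : row_free M by rewrite /row_free mxrankMfree.
have Mv : M *m v^T = 0 by rewrite /M -mulmxA.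
have vM : v *m M^T = 0 by rewrite -[LHS]trmxK trmx_mul trmxK Mv trmx0.
(* [T] changes the basis of the row space to [v] followed by [M]. It multiplies both determinants by
   [\det T ^+ 2], so the inequality may be proved for [col_mx v M], whose Gram matrix is block
   diagonal. *)
pose T := col_mx w K.
have TS : T *m S = col_mx v M by rewrite mul_col_mx.
have sq N : \det (T *m (S *m N *m S^T) *m T^T) = \det T ^+ 2 * \det (S *m N *m S^T).
  by rewrite !det_mulmx det_tr expr2; ring.
have tr N : T *m (S *m N *m S^T) *m T^T = col_mx v M *m N *m (col_mx v M)^T.
  by rewrite -TS trmx_mul !mulmxA.
have e1 : \det T ^+ 2 * \det (S *m S^T) = (v *m v^T) 0 0 * \det (M *m M^T).
  have := sq 1%:M; rewrite tr !mulmx1 => <-.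
  by rewrite tr_col_mx mul_col_row Mv vM det_ublock det_mx11.
have M0 : 0 < \det (M *m M^T).
  have := posdef_det_gt0 (posdef_congr (posdef_scalar1 n) Mf).
  by rewrite mulmx1.
have T0 : \det T != 0.
  apply: contraTneq (mulr_gt0 (quad_form_gt0 v0) M0) => T0.
  by rewrite -e1 T0 expr0n mul0r ltxx.
have T20 : 0 < \det T ^+ 2 by rewrite exprn_even_gt0.
have vMf : row_free (col_mx v M).
  by rewrite -TS /row_free mxrankMfree// -/(row_free T) row_free_unit unitmxE unitfE.
rewrite -(ler_pM2l T20) -sq tr mulrCA e1 prod_prefixS.
have := posdef_congr hD vMf.
rewrite tr_col_mx mul_col_mx mul_col_row.
rewrite [v *m D *m v^T]mx11_scalar.
have -> : M *m D *m v^T = (v *m D *m M^T)^T.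
  by rewrite (trmx_mul (v *m D)) (trmx_mul v D) trmxK hD.1 mulmxA.
move=> /fischer/le_trans; apply.
rewrite mulrACA [leRHS]mulrC [leRHS]mulrC.
apply: ler_pM.
- by rewrite ltW//; have := hD.2 v^T; rewrite trmxK trmx_eq0; apply.
- by rewrite ltW// posdef_det_gt0//; exact: posdef_congr.
- exact: diag_quad_le.
- exact: IH.
Qed.

End trace_max.

Section eigenbasis.
Context {R : realType} {n : nat}.
Variables (A C : 'M[R]_n).
Hypotheses (Asym : A^T = A) (hC : sym_posdef C).

Lemma gen_eigen_row mu (u : 'rV[R]_n) :
  (u <= gen_eigenspace A C mu)%MS -> u *m A = mu *: (u *m C).
Proof.
rewrite -[u]trmxK => /gen_eigenspaceP/(congr1 trmx).
by rewrite trmx_mul Asym linearZ/= trmx_mul hC.1.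
Qed.

(** Gram-Schmidt through Cholesky: if the Gram matrix of a basis is [L L^T], multiplying the basis
    by [L^-1] makes it [C]-orthonormal. Indexing by [nat] gives the family a type independent of
    [mu], so that one can be chosen for every [mu] at once. *)
Lemma gen_eigenspace_orthonormal mu : exists e : nat -> 'rV[R]_n,
  (forall k, (k < \rank (gen_eigenspace A C mu))%N ->
    (e k <= gen_eigenspace A C mu)%MS) /\
  (forall k l, (k < \rank (gen_eigenspace A C mu))%N ->
    (l < \rank (gen_eigenspace A C mu))%N ->
    e k *m C *m (e l)^T = (k == l)%:R%:M).
Proof.
set K := gen_eigenspace A C mu.
have [L Lu LE] := posdef_cholesky (posdef_congr hC (row_base_free K)).
pose F := invmx L *m row_base K.
have FF : F *m C *m F^T = 1%:M.
  transitivity (invmx L *m (row_base K *m C *m (row_base K)^T) *m (invmx L)^T).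
    by rewrite /F trmx_mul !mulmxA.
  by rewrite LE mulmxA mulVmx// mul1mx -trmx_mul mulVmx// trmx1.
exists (fun k => if insub k is Some i then row i F else 0); split.
  move=> k kK; rewrite insubT; apply: (submx_trans (row_sub _ _)).
  by rewrite (submx_trans (submxMl _ _))// eq_row_base.
move=> k l kK lK; rewrite !insubT -row_mul tr_row -[RHS]trmxK.
apply/matrixP => i j; rewrite !ord1 !mxE.
have := congr1 (fun M : 'M[R]_(\rank K) => M (Ordinal kK) (Ordinal lK)) FF.
rewrite !mxE mulr1n -val_eqE/= => <-.
by apply: eq_bigr => x _; rewrite !mxE.
Qed.

(* Rows of [U]: the multiplicities in [gen_eigenvalues] are dimensions of
   eigenspaces, so orthonormal bases of the eigenspaces already fill [R^n]. *)
Lemma gen_eigenbasis lam : gen_eigenvalues A C lam ->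
  exists2 U : 'M[R]_n, U *m C *m U^T = 1%:M &
    U *m A *m U^T = diag_mx (\row_i lam i).
Proof.
move=> [_ hlam].
have /(@choice R _)[e he] := gen_eigenspace_orthonormal.
(* [k i] is the rank of [i] among the indices sharing its eigenvalue. There are as many of these as
   the dimension of the eigenspace, so [u i] can be the [k i]-th vector of its orthonormal basis. *)
pose s i := enum [pred j | lam j == lam i].
pose k i := index i (s i).
have kK i : (k i < \rank (gen_eigenspace A C (lam i)))%N.
  by rewrite -hlam cardE index_mem mem_enum inE.
pose u i := e (lam i) (k i).
have uK i : (u i <= gen_eigenspace A C (lam i))%MS by exact: (he _).1.
have uC i j : u i *m C *m (u j)^T = (i == j)%:R%:M.
  (* Equal eigenvalues: both vectors come from one orthonormal family, and positions in the common
     list determine the index. Distinct eigenvalues: moving [A] from one side of the pairing to the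
     other multiplies it by [lam i] and by [lam j], so it vanishes. *)
  have [eij|nij] := eqVneq (lam i) (lam j).
    rewrite /u -eij (he _).2//; last by rewrite eij.
    congr ((nat_of_bool _)%:R)%:M; apply/eqP/eqP => [|->//].
    rewrite /k /s -eij => h; rewrite -(@nth_index _ i i (s i)); last first.
      by rewrite mem_enum inE.
    by rewrite [index i _]h nth_index// mem_enum inE eij.
  have -> : (i == j) = false by apply: contra_neqF nij => /eqP ->.
  apply/eqP; rewrite raddf0.
  have : lam i *: (u i *m C *m (u j)^T) = lam j *: (u i *m C *m (u j)^T).
    rewrite scalemxAl -(gen_eigen_row (uK i)) -mulmxA -{1}Asym -trmx_mul.
    by rewrite (gen_eigen_row (uK j)) linearZ/= -scalemxAr trmx_mul hC.1 mulmxA.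
  move/eqP; rewrite -subr_eq0 -scalerBl scaler_eq0 subr_eq0.
  by rewrite (negbTE nij).
have E M i j : ((\matrix_i u i) *m M *m (\matrix_i u i)^T) i j = (u i *m M *m (u j)^T) 0 0.
  rewrite -[in LHS]mulmxA -[in RHS]mulmxA !mxE; apply: eq_bigr => l _.
  rewrite !mxE; congr (_ * _); apply: eq_bigr => l' _; by rewrite !mxE.
exists (\matrix_i u i); apply/matrixP => i j; rewrite E.
  by rewrite uC !mxE.
by rewrite (gen_eigen_row (uK i)) -scalemxAl uC !mxE mulr1n mulr_natr.
Qed.

End eigenbasis.

(** * Linear change of variables *)

Section linear_change_of_variables.
Context {R : realType}.
Local Open Scope ereal_scope.
Local Notation leb := (@lebesgue_measure R).
Local Notation mu n := (@lebesgue_cV R n).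

(** For [a > 0], the image of Lebesgue measure under the affine map, multiplied by [a], gives every
    interval its length, so it is Lebesgue measure by uniqueness. Reflection reduces [a < 0] to this
    case. *)
Lemma ge0_integral_scale_shift (a b : R) (f : measurableTypeR R -> \bar R) :
  a != 0%R -> measurable_fun [set: measurableTypeR R] f -> (forall x, 0 <= f x) ->
  \int[leb]_x f (a * x + b)%R = (`|a|^-1)%:E * \int[leb]_x f x.
Proof.
wlog a0 : a b f / (0 < a)%R.
  move=> h aN0 mf f0; have [a0|] := ltP 0%R a; first exact: h.
  rewrite le_eqVlt (negbTE aN0)/= => a0.
  have mN : measurable_fun [set: measurableTypeR R] (-%R : _ -> measurableTypeR R).
    exact: oppr_measurable.
  have := h (- a)%R (- b)%R (f \o -%R).
  rewrite oppr_gt0 oppr_eq0 normrN => /(_ a0 aN0).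
  have -> : \int[leb]_x (f \o -%R) x = \int[leb]_x f x.
    rewrite -[LHS](@ge0_integral_pushforward _ _ _ _ _ _ mN leb setT f)//.
    by apply: eq_measure_integral => //= A mA _; exact/lebesgue_measureN.
  move=> <-; [|exact: (measurableT_comp mf mN)|by move=> x; exact: f0].
  by apply: eq_integral => x _ /=; rewrite mulNr opprD !opprK.
move=> aN0 mf f0; rewrite gtr0_norm//.
pose phi (x : measurableTypeR R) : measurableTypeR R := (a * x + b)%R.
have mphi : measurable_fun setT phi.
  by apply: measurable_funD => //; exact: measurable_funM.
rewrite -[LHS](@ge0_integral_pushforward _ _ _ _ _ _ mphi leb setT f)//.
have ai0 : (0 <= a^-1)%R by rewrite invr_ge0 ltW.
rewrite -[RHS](@ge0_integral_mscale _ _ R leb setT measurableT (NngNum ai0))//.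
apply: eq_measure_integral => //= A mA _.
have mpush A' : measurable A' -> measurable (phi @^-1` A').
  by move=> mA'; rewrite -[X in measurable X]setTI; exact: mphi.
suff : leb A = mscale (NngNum (ltW a0)) (pushforward leb phi) A.
  move=> /(_ mphi) hA; rewrite /mscale/= hA /mscale/=.
  by rewrite muleA -EFinM mulVf// mul1e.
move=> mphi'; apply: lebesgue_measure_unique => //= _ [[c d]] _ <-.
rewrite /mscale/= /pushforward.
rewrite (_ : phi @^-1` _ = `](c - b) / a, (d - b) / a]%classic)%R; last first.
  apply/seteqP; split=> x/=; rewrite !in_itv/= /phi.
    by rewrite ltr_pdivrMr// ler_pdivlMr// ltrBlDr lerBrDr mulrC.
  by rewrite ltr_pdivrMr// ler_pdivlMr// ltrBlDr lerBrDr mulrC.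
rewrite !lebesgue_measure_itv/= !lte_fin ltr_pM2r ?invr_gt0// ltrD2r.
case: ifPn => _; last by rewrite mule0.
by rewrite -!EFinD -EFinM -mulrBl mulrC divfK//; congr (_%:E); ring.
Qed.

Lemma ge0_integral_cV_cons n (f : 'cV[R]_n.+1 -> \bar R) :
  measurable_fun [set: 'cV[R]_n.+1] f -> (forall x, 0 <= f x) ->
  \int[mu n.+1]_x f x = \int[leb]_a \int[mu n]_v f (cV_cons (a, v)).
Proof.
move=> mf f0.
rewrite [LHS](@ge0_integral_pushforward _ _ _ _ _ _ (@measurable_cV_cons R n)
  (leb \x mu n)%E setT f)//.
rewrite preimage_setT fubini_tonelli1//; last by move=> p; exact: f0.
exact: (measurableT_comp mf (@measurable_cV_cons R n)).
Qed.

Lemma ge0_integral_cV_cons_swap n (f : 'cV[R]_n.+1 -> \bar R) :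
  measurable_fun [set: 'cV[R]_n.+1] f -> (forall x, 0 <= f x) ->
  \int[mu n.+1]_x f x = \int[mu n]_v \int[leb]_a f (cV_cons (a, v)).
Proof.
move=> mf f0; rewrite ge0_integral_cV_cons//.
rewrite (fubini_tonelli (f \o @cV_cons R n))//; last by move=> p; exact: f0.
exact: (measurableT_comp mf (@measurable_cV_cons R n)).
Qed.

Lemma measurable_integral_cV_cons n (f : 'cV[R]_n.+1 -> \bar R) :
  measurable_fun [set: 'cV[R]_n.+1] f -> (forall x, 0 <= f x) ->
  measurable_fun setT
    (fun a : measurableTypeR R => \int[mu n]_v f (cV_cons (a, v))).
Proof.
move=> mf f0; apply: (measurable_fun_fubini_tonelli_F (f \o @cV_cons R n)).
  exact: (measurableT_comp mf (@measurable_cV_cons R n)).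
by move=> p; exact: f0.
Qed.

Lemma measurable_cV_affine m n (A : 'M[R]_(m, n)) (b : 'cV[R]_m) :
  measurable_fun setT (fun x : 'cV[R]_n => A *m x + b : 'cV[R]_m)%R.
Proof.
apply/measurable_fun_cVP => i.
rewrite (_ : _ \o _ =
    (fun x : 'cV[R]_n => (\sum_j A i j * cV_coor j x + b i 0)%R)); last first.
  by apply/funext => x; rewrite /cV_coor/= !mxE.
apply: measurable_funD => //; apply: measurable_sum => j.
by apply: measurable_funM => //; exact: measurable_cV_coor.
Qed.

Lemma measurable_cV_linear m n (A : 'M[R]_(m, n)) :
  measurable_fun setT (fun x : 'cV[R]_n => A *m x : 'cV[R]_m)%R.
Proof.
rewrite (_ : mulmx A = fun x => A *m x + 0)%R; first exact: measurable_cV_affine.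
by apply/funext => x; rewrite addr0.
Qed.

Lemma measurable_cV_shift n (c : 'cV[R]_n) :
  measurable_fun setT (fun x : 'cV[R]_n => x + c)%R.
Proof.
rewrite (_ : (fun x => _) = fun x => 1%:M *m x + c)%R; first exact: measurable_cV_affine.
by apply/funext => x; rewrite mul1mx.
Qed.

Lemma measurable_cV_cons_l n (a : measurableTypeR R) :
  measurable_fun setT (fun v : 'cV[R]_n => cV_cons (a, v)).
Proof.
by apply: (measurableT_comp (@measurable_cV_cons R n)); exact: pair1_measurable.
Qed.

Lemma measurable_cV_cons_r n (v : 'cV[R]_n) :
  measurable_fun setT (fun a : measurableTypeR R => cV_cons (a, v)).
Proof.
by apply: (measurableT_comp (@measurable_cV_cons R n)); exact: pair2_measurable.
Qed.

Lemma ge0_integral_cV_shift n (c : 'cV[R]_n) (f : 'cV[R]_n -> \bar R) :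
  measurable_fun [set: 'cV[R]_n] f -> (forall x, 0 <= f x) ->
  \int[mu n]_x f (x + c)%R = \int[mu n]_x f x.
Proof.
elim: n c f => [|n IH] c f mf f0.
  by apply: eq_integral => x _; congr f; apply/matrixP => -[].
have mfc := measurableT_comp mf (measurable_cV_shift c).
rewrite !ge0_integral_cV_cons//.
pose g (a : measurableTypeR R) := \int[mu n]_v f (cV_cons (a, v)).
have mg := measurable_integral_cV_cons mf f0.
transitivity (\int[leb]_a g (1 * a + c 0 0)%R); last first.
  rewrite ge0_integral_scale_shift ?normr1 ?invr1 ?mul1e//.
  by move=> a; apply: integral_ge0 => v _; exact: f0.
apply: eq_integral => a _; rewrite /g.
rewrite -(IH (\col_i c (lift 0 i) 0)%R (fun v => f (cV_cons (_, v)))) //; last first.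
  exact: (measurableT_comp mf (measurable_cV_cons_l _)).
apply: eq_integral => v _; congr f; apply/colP => i.
have [j ->|->] := fintype.unliftP 0%R i.
  by rewrite [LHS]mxE !cV_consS !mxE.
by rewrite [LHS]mxE !cV_cons0 mul1r.
Qed.

(** The change of variables formula as a predicate on the matrix, so that it passes from the factors
    of a matrix product to the product. *)
Definition scales_lebesgue n (A : 'M[R]_n) :=
  forall f : 'cV[R]_n -> \bar R, measurable_fun [set: 'cV[R]_n] f -> (forall x, 0 <= f x) ->
  \int[mu n]_x f (A *m x)%R = (`|\det A|^-1)%:E * \int[mu n]_x f x.

Lemma scales_lebesgueM n (A B : 'M[R]_n) :
  scales_lebesgue A -> scales_lebesgue B -> scales_lebesgue (A *m B).
Proof.
move=> hA hB f mf f0; under eq_integral do rewrite -mulmxA.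
rewrite (hB (fun x => f (A *m x)))//.
  by rewrite hA// muleA -EFinM -invfM -normrM det_mulmx mulrC.
exact: (measurableT_comp mf (measurable_cV_linear A)).
Qed.

(** With the first coordinate [x] fixed, the remaining ones undergo [S] followed by a translation by
    [x *: c], which contributes the factor of [S]; the outer integral is then a scaling by [a]. *)
Lemma scales_lebesgue_lblock n (a : R) (c : 'cV[R]_n) (S : 'M[R]_n) :
  a != 0%R -> scales_lebesgue S ->
  scales_lebesgue (block_mx a%:M 0 c S : 'M[R]_n.+1)%R.
Proof.
move=> a0 hS f mf f0.
have mfA := measurableT_comp mf (measurable_cV_linear
  (block_mx a%:M 0 c S : 'M[R]_n.+1)%R).
rewrite !ge0_integral_cV_cons//.
pose g (a : measurableTypeR R) := \int[mu n]_v f (cV_cons (a, v)).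
have mg : measurable_fun setT g := measurable_integral_cV_cons mf f0.
have g0 x : 0 <= g x by apply: integral_ge0 => v _; exact: f0.
transitivity (\int[leb]_x ((`|\det S|^-1)%:E * g (a * x + 0)%R)).
  apply: eq_integral => x _.
  transitivity (\int[mu n]_v f (cV_cons ((a * x + 0)%R, S *m v + x *: c)%R)).
    apply: eq_integral => v _; congr f; rewrite /cV_cons/=.
    rewrite [LHS](mul_block_col a%:M 0%R c S x%:M v)%R mul0mx addr0.
    by rewrite -scalar_mxM addr0 mul_mx_scalar addrC.
  have mfc y : measurable_fun setT (fun v => f (cV_cons (y, v))).
    exact: (measurableT_comp mf (measurable_cV_cons_l _)).
  rewrite (hS (fun v => f (cV_cons ((a * x + 0)%R, v + x *: c)%R)))//.
    by rewrite (ge0_integral_cV_shift _ (f := fun v => f (cV_cons (_, v)))).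
  exact: (measurableT_comp (mfc _) (measurable_cV_shift _)).
have maff : measurable_fun [set: measurableTypeR R]
    (fun x : measurableTypeR R => (a * x + 0)%R : measurableTypeR R).
  by apply: measurable_funD => //; exact: measurable_funM.
have mga := measurableT_comp mg maff.
transitivity ((`|\det S|^-1)%:E * \int[leb]_x g (a * x + 0)%R).
  by apply: (ge0_integralZl leb measurableT mga) => [x _|];
    [exact: g0|rewrite lee_fin invr_ge0].
rewrite ge0_integral_scale_shift// muleA -EFinM; congr (_%:E * _).
by rewrite (det_lblock a%:M c S)%R det_scalar1 normrM invfM mulrC.
Qed.

(** Tonelli in the other order: with the last coordinates [v] fixed, the shear translates the first
    one by [b v]. *)
Lemma scales_lebesgue_ublock1 n (b : 'rV[R]_n) :
  scales_lebesgue (block_mx 1%:M b 0 1%:M : 'M[R]_n.+1)%R.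
Proof.
move=> f mf f0.
have mfA := measurableT_comp mf (measurable_cV_linear
  (block_mx 1%:M b 0 1%:M : 'M[R]_n.+1)%R).
rewrite (det_ublock 1%:M b 1%:M)%R !det1 mulr1 normr1 invr1 mul1e.
rewrite !ge0_integral_cV_cons_swap//.
apply: eq_integral => v _.
transitivity (\int[leb]_a f (cV_cons ((1 * a + (b *m v) 0 0)%R, v))).
  apply: eq_integral => a _; congr f; rewrite /cV_cons/=.
  rewrite [LHS](mul_block_col 1%:M b 0 1%:M a%:M v)%R mul0mx add0r !mul1mx.
  by rewrite mul1r raddfD/= -mx11_scalar.
rewrite (ge0_integral_scale_shift _ (f := fun a => f (cV_cons (a, v))))//.
  by rewrite normr1 invr1 mul1e.
exact: (measurableT_comp mf (measurable_cV_cons_r _)).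
Qed.

(* After a shear making the upper left entry nonzero, a Schur complement step
   writes the matrix as a product of block triangular ones. *)
Lemma scales_lebesgue_unit n (A : 'M[R]_n) : A \in unitmx -> scales_lebesgue A.
Proof.
elim: n A => [|n IH] A Au.
  move=> f mf f0; rewrite det_mx00 normr1 invr1 mul1e; apply: eq_integral.
  by move=> x _; congr f; apply/matrixP => -[].
move: A Au; rewrite -[n.+1]/(1 + n)%N => A Au.
have pivot (B : 'M[R]_(1 + n)) : B \in unitmx -> (ulsubmx B) 0%R 0%R != 0%R ->
    scales_lebesgue B.
  set a := _ 0%R 0%R => Bu a0.
  pose S := (drsubmx B - a^-1 *: (dlsubmx B *m ursubmx B))%R.
  have BE : B = (block_mx a%:M 0 (dlsubmx B) S *m
      block_mx 1%:M (a^-1 *: ursubmx B) 0 1%:M)%R.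
    rewrite mulmx_block !mul0mx !mulmx0 !mulmx1 !addr0.
    rewrite mul_scalar_mx scalerA divff// scale1r -scalemxAr addrC subrK.
    by rewrite -mx11_scalar submxK.
  rewrite BE; apply: scales_lebesgueM; last exact: scales_lebesgue_ublock1.
  apply: scales_lebesgue_lblock => //; apply: IH.
  move: Bu; rewrite BE unitmxE det_mulmx det_lblock !unitrM.
  by move=> /andP[/andP[_]]; rewrite -unitmxE.
have [a0|] := eqVneq ((ulsubmx A) 0%R 0%R) 0%R; last exact: pivot.
pose c := dlsubmx A.
have c0 : c != 0%R.
  apply: contraTneq Au => c0; rewrite unitmxE -(submxK A) -/c c0.
  by rewrite [ulsubmx A]mx11_scalar a0 det_ublock det_scalar1 mul0r unitr0.
(* Shearing by [c^T] turns the zero upper left entry into [c^T c], which is positive since [c] is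
   nonzero. *)
have AE : A = (block_mx 1%:M (- c^T) 0 1%:M *m
    (block_mx 1%:M c^T 0 1%:M *m A))%R.
  rewrite mulmxA mulmx_block !mul0mx !mulmx0 !mul1mx !mulmx1 !addr0 add0r.
  by rewrite subrr -scalar_mx_block mul1mx.
rewrite AE; apply: scales_lebesgueM; first exact: scales_lebesgue_ublock1.
apply: pivot.
  by rewrite unitmxE det_mulmx det_ublock !det1 !mul1r -unitmxE.
rewrite -{1}(submxK A) mulmx_block block_mxKul mul1mx -/c mxE a0 add0r.
have := quad_form_gt0 (v := c^T); rewrite trmxK trmx_eq0 => /(_ c0).
by move/lt0r_neq0.
Qed.

End linear_change_of_variables.

(** * Integration against a measure given by a density *)

Section density_integral.
Context {R : realType} d (X : measurableType d).
Local Open Scope ereal_scope.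
Variables (mu nu : {measure set X -> \bar R}) (f : X -> R).
Hypotheses (mf : measurable_fun [set: X] f) (f0 : forall x, (0 <= f x)%R)
  (nuE : forall A, measurable A -> nu A = \int[mu]_(x in A) (f x)%:E).

Import HBNNSimple.

Let mEf : measurable_fun [set: X] (EFin \o f).
Proof. exact/measurable_EFinP. Qed.

(** For a simple function this is [nuE] on its level sets; monotone convergence on both sides
    extends it to nonnegative [g]. *)
Lemma ge0_integral_density (g : X -> \bar R) :
  measurable_fun [set: X] g -> (forall x, 0 <= g x) ->
  \int[nu]_x g x = \int[mu]_x (g x * (f x)%:E).
Proof.
move=> mg g0; pose g_ := nnsfun_approx measurableT mg.
have g_cvg x : EFin \o g_^~ x @ \oo --> g x by exact: cvg_nnsfun_approx.
have mg_ n : measurable_fun [set: X] (EFin \o g_ n) by exact/measurable_EFinP.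
transitivity (limn (fun n => \int[nu]_x (g_ n x)%:E)).
  rewrite -monotone_convergence//.
  - by apply: eq_integral => x _; apply/esym/cvg_lim => //; exact: g_cvg.
  - by move=> n x _; rewrite lee_fin.
  - by move=> x _ m n mn; rewrite lee_fin; exact/lefP/nd_nnsfun_approx.
transitivity (limn (fun n => \int[mu]_x ((g_ n x)%:E * (f x)%:E))); last first.
  rewrite -monotone_convergence//.
  - apply: eq_integral => x _; apply/cvg_lim => //.
    by apply: cvgeZr => //; exact: g_cvg.
  - by move=> n; exact: (emeasurable_funM (mg_ n) mEf).
  - by move=> n x _; rewrite mule_ge0// lee_fin.
  - move=> x _ m n mn; rewrite lee_wpmul2r ?lee_fin//.
    exact/lefP/nd_nnsfun_approx.
congr (limn _); apply/funext => n; rewrite integralT_nnsfun sintegralE.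
pose A r := g_ n @^-1` [set r].
have mA r : measurable (A r).
  by rewrite /A -[X in measurable X]setTI; exact: measurable_funP.
transitivity (\int[mu]_x \sum_(r \in range (g_ n)) (r%:E * ((EFin \o f) \_ (A r)) x)).
  rewrite ge0_integral_fsum//; last 2 first.
  - move=> r; apply: measurable_funeM.
    apply: (measurable_restrictT _ (mA r)).1; exact: measurable_funTS.
  - move=> r x _; rewrite patchE; case: ifPn => [|_]; last by rewrite mule0.
    by rewrite inE => <-; rewrite -EFinM lee_fin mulr_ge0.
  apply: eq_fsbigr => r /set_mem[x _ <-].
  rewrite ge0_integralZl//.
  - by rewrite -integral_mkcond nuE.
  - apply: (measurable_restrictT _ (mA _)).1; exact: measurable_funTS.
  - by move=> y _; apply: erestrict_ge0 => z _; rewrite lee_fin.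
  - by rewrite lee_fin.
apply: eq_integral => x _.
rewrite (fsbigD1 (g_ n x))//=; last by exists x.
rewrite patchE mem_set// fsbig1 ?adde0// => r [_ /eqP rx].
by rewrite patchE memNset ?mule0// => /= h; case/eqP: rx; exact/esym.
Qed.

End density_integral.

(** * Lebesgue measure on a stacked space and affine changes of variables *)

Section lebesgue_col_mx.
Context {R : realType}.
Local Open Scope ereal_scope.
Local Notation mu n := (@lebesgue_cV R n).

Lemma measurable_col_mx m n :
  measurable_fun setT (fun p : 'cV[R]_m * 'cV[R]_n => col_mx p.1 p.2).
Proof.
apply/measurable_fun_cVP => i; rewrite /cV_coor/=.
case: (splitP i) => j ij.
  have -> : i = lshift n j by exact/val_inj.
  rewrite (_ : _ \o _ = cV_coor j \o fst).
    by apply: measurableT_comp; [exact: measurable_cV_coor|exact: measurable_fst].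
  by apply/funext => p /=; rewrite col_mxEu.
have -> : i = rshift m j by exact/val_inj.
rewrite (_ : _ \o _ = cV_coor j \o snd).
  by apply: measurableT_comp; [exact: measurable_cV_coor|exact: measurable_snd].
by apply/funext => p /=; rewrite col_mxEd.
Qed.

(** [m.+1 + n] and [(m + n).+1] are convertible, so both sides have one type. This associativity
    drives the induction that splits Lebesgue measure on a stacked space. *)
Lemma col_mx_cV_cons m n (a : R) (x : 'cV[R]_m) (y : 'cV[R]_n) :
  col_mx (cV_cons (a, x)) y = cV_cons (a, col_mx x y) :> 'cV[R]_(m.+1 + n).
Proof.
apply/colP => i; case: (splitP i) => j ij.
  have -> : i = lshift n j by exact/val_inj.
  rewrite col_mxEu; have [k ->|->] := fintype.unliftP 0%R j.
    rewrite cV_consS.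
    have -> : lshift n (lift 0%R k) = lift 0%R (lshift n k) :> 'I_(m + n).+1.
      exact/val_inj.
    by rewrite cV_consS col_mxEu.
  rewrite cV_cons0; have -> : lshift n 0%R = 0%R :> 'I_(m + n).+1 by exact/val_inj.
  by rewrite cV_cons0.
have -> : i = lift 0%R (rshift m j) :> 'I_(m + n).+1 by exact/val_inj.
rewrite cV_consS col_mxEd.
have -> : lift 0%R (rshift m j) = rshift m.+1 j :> 'I_(m.+1 + n) by exact/val_inj.
by rewrite col_mxEd.
Qed.

Lemma ge0_integral_cV_col_mx m n (f : 'cV[R]_(m + n) -> \bar R) :
  measurable_fun [set: 'cV[R]_(m + n)] f -> (forall x, 0 <= f x) ->
  \int[mu (m + n)]_z f z = \int[mu m]_x \int[mu n]_y f (col_mx x y).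
Proof.
elim: m f => [|m IH] f mf f0.
  transitivity (\int[mu 0]_(x in [set: 'cV[R]_0]) (\int[mu n]_y f (col_mx 0 y)%R)).
    rewrite integral_cst// [X in _ * X]diracT mule1; apply: eq_integral => y _.
    congr f; apply/colP => i; rewrite -[i in RHS](_ : rshift 0 i = i) ?col_mxEd//.
    exact/val_inj.
  apply: eq_integral => x _; apply: eq_integral => y _; congr (f (col_mx _ _)).
  by apply/matrixP => -[].
have mF (x : 'cV[R]_m.+1 ) : 0 <= \int[mu n]_y f (col_mx x y).
  by apply: integral_ge0 => y _; exact: f0.
rewrite [LHS](@ge0_integral_cV_cons R (m + n) f mf f0).
rewrite ge0_integral_cV_cons//; last first.
  apply: (measurable_fun_fubini_tonelli_F
    (f \o (fun p : 'cV[R]_m.+1 * 'cV[R]_n => col_mx p.1 p.2))) => [|p].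
    exact: (measurableT_comp mf (@measurable_col_mx m.+1 n)).
  exact: f0.
apply: eq_integral => a _.
rewrite (IH (fun v => f (cV_cons (a, v))))//.
  apply: eq_integral => x _; apply: eq_integral => y _.
  by rewrite col_mx_cV_cons.
exact: (measurableT_comp mf (measurable_cV_cons_l _)).
Qed.

Lemma ge0_integral_cV_affine n (A : 'M[R]_n) (b : 'cV[R]_n)
    (f : 'cV[R]_n -> \bar R) : A \in unitmx ->
  measurable_fun [set: 'cV[R]_n] f -> (forall x, 0 <= f x) ->
  \int[mu n]_x f (A *m x + b)%R = (`|\det A|^-1)%:E * \int[mu n]_x f x.
Proof.
move=> Au mf f0; rewrite (scales_lebesgue_unit Au (f := fun x => f (x + b)%R))//.
  by rewrite ge0_integral_cV_shift.
exact: (measurableT_comp mf (measurable_cV_shift _)).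
Qed.

End lebesgue_col_mx.

(** * Gaussian densities and Gaussian vectors *)

Section gaussian_pdf.
Context {R : realType}.
Local Notation mu n := (@lebesgue_cV R n).

Lemma measurable_quad_form n (M : 'M[R]_n) :
  measurable_fun setT (fun x : 'cV[R]_n => (x^T *m M *m x) 0 0).
Proof.
rewrite (_ : (fun x => _) = (fun x : 'cV[R]_n =>
    \sum_j (\sum_i cV_coor i x * M i j) * cV_coor j x)); last first.
  apply/funext => x; rewrite mxE; apply: eq_bigr => j _; rewrite mxE.
  by congr (_ * _); apply: eq_bigr => i _; rewrite mxE.
apply: measurable_sum => j; apply: measurable_funM; last exact: measurable_cV_coor.
apply: measurable_sum => i; apply: measurable_funM => //.
exact: measurable_cV_coor.
Qed.

Lemma measurable_gaussian_pdf n (m : 'cV[R]_n) C :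
  measurable_fun [set: 'cV[R]_n] (gaussian_pdf m C).
Proof.
apply: measurable_funM => //; apply: measurableT_comp => //.
apply: measurable_funM => //; apply: measurableT_comp => //.
exact: (measurableT_comp (measurable_quad_form (invmx C)) (measurable_cV_shift (- m))).
Qed.

Lemma measurable_gaussian_pdf_EFin n (m : 'cV[R]_n) C :
  measurable_fun [set: 'cV[R]_n] (fun x => (gaussian_pdf m C x)%:E).
Proof. by apply/measurable_EFinP; exact: measurable_gaussian_pdf. Qed.

Lemma gaussian_pdf_ge0 n (m : 'cV[R]_n) C x : 0 <= gaussian_pdf m C x.
Proof. by rewrite /gaussian_pdf divr_ge0 ?expR_ge0 ?sqrtr_ge0. Qed.

(** The quadratic form is invariant, and the covariance determinant gains [\det A ^+ 2], whose
    square root is the Jacobian factor. *)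
Lemma gaussian_pdf_affine n (A : 'M[R]_n) (b m : 'cV[R]_n) C x :
  A \in unitmx -> sym_posdef C ->
  gaussian_pdf (A *m m + b) (A *m C *m A^T) (A *m x + b) =
  gaussian_pdf m C x / `|\det A|.
Proof.
move=> Au hC; rewrite /gaussian_pdf.
have -> : A *m x + b - (A *m m + b) = A *m (x - m).
  by rewrite mulmxBr opprD addrACA subrr addr0.
have -> : (A *m (x - m))^T *m invmx (A *m C *m A^T) *m (A *m (x - m)) =
    (x - m)^T *m invmx C *m (x - m).
  have Cu := posdef_unit hC.
  have -> : invmx (A *m C *m A^T) = invmx A^T *m invmx C *m invmx A.
    have ACAu : A *m C *m A^T \in unitmx by rewrite !unitmx_mul unitmx_tr Au Cu.
    apply: (can_inj (mulKmx ACAu)); rewrite mulmxV// !mulmxA.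
    by rewrite mulmxK ?unitmx_tr// mulmxK// mulmxV.
  by rewrite trmx_mul !mulmxA mulmxK ?unitmx_tr// mulmxKV.
rewrite -mulrA -invfM; congr (_ / _).
have -> : (2 * pi) ^+ n * \det (A *m C *m A^T) =
    (2 * pi) ^+ n * \det C * \det A ^+ 2 by rewrite !det_mulmx det_tr; ring.
rewrite sqrtrM ?sqrtr_sqr//.
by rewrite mulr_ge0 ?exprn_ge0 ?mulr_ge0 ?pi_ge0// ltW// posdef_det_gt0.
Qed.

Lemma gaussian_pdf_col_mx k n (m0 : 'cV[R]_k) (m1 : 'cV[R]_n) C0 C1 x y :
  sym_posdef C0 -> sym_posdef C1 ->
  gaussian_pdf (col_mx m0 m1) (block_mx C0 0 0 C1) (col_mx x y) =
  gaussian_pdf m0 C0 x * gaussian_pdf m1 C1 y.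
Proof.
move=> h0 h1; have u0 := posdef_unit h0; have u1 := posdef_unit h1.
have -> : gaussian_pdf m0 C0 x * gaussian_pdf m1 C1 y =
    expR (- ((x - m0)^T *m invmx C0 *m (x - m0)) 0 0 / 2 +
          - ((y - m1)^T *m invmx C1 *m (y - m1)) 0 0 / 2) /
    (Num.sqrt ((2 * pi) ^+ k * \det C0) * Num.sqrt ((2 * pi) ^+ n * \det C1)).
  by rewrite expRD invfM mulrACA.
rewrite /gaussian_pdf; congr (expR _ / _).
  have -> : invmx (block_mx C0 0 0 C1) = block_mx (invmx C0) 0 0 (invmx C1).
    have Cu : block_mx C0 0 0 C1 \in unitmx.
      exact/posdef_unit/posdef_block_diag.
    apply: (can_inj (mulKmx Cu)); rewrite mulmxV// mulmx_block.
    by rewrite !mulmxV// !mulmx0 !mul0mx !addr0 add0r -scalar_mx_block.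
  rewrite opp_col_mx add_col_mx tr_col_mx mul_row_block !mulmx0 addr0 add0r.
  by rewrite mul_row_col [in LHS]mxE -mulrDl opprD.
rewrite -sqrtrM; last first.
  by rewrite mulr_ge0 ?exprn_ge0 ?mulr_ge0 ?pi_ge0// ltW// posdef_det_gt0.
by rewrite det_ublock exprD; congr Num.sqrt; ring.
Qed.

Lemma gaussian_pdf_scalar1 (a : R) :
  gaussian_pdf 0 1%:M (a%:M : 'cV_1) = normal_pdf 0 1 a.
Proof.
rewrite normal_pdfE ?oner_neq0// /gaussian_pdf /normal_peak /normal_fun.
rewrite mulrC det1 mulr1 expr1 subr0 invmx1 mulmx1 tr_scalar_mx -scalar_mxM.
rewrite mxE eqxx mulr1n expr1n !mul1r subr0 -expr2; congr (_^-1 * expR _).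
by congr Num.sqrt; rewrite mulr_natl.
Qed.

Local Open Scope ereal_scope.

Let mE := measurable_gaussian_pdf_EFin.

Let ge0 n (m : 'cV[R]_n) C x : 0 <= (gaussian_pdf m C x)%:E.
Proof. by rewrite lee_fin gaussian_pdf_ge0. Qed.

Lemma integral_gaussian_pdf_std n :
  \int[mu n]_x (gaussian_pdf 0 1%:M x)%:E = 1.
Proof.
elim: n => [|n IH].
  transitivity (\int[mu 0]_(x in [set: 'cV[R]_0]) (cst 1 x)).
    apply: eq_integral => x _; rewrite /gaussian_pdf/= expr0 det_mx00 mul1r.
    by rewrite sqrtr1 divr1 subr0 mxE big_ord0 oppr0 mul0r expR0.
  by rewrite integral_cst// mul1e; exact: diracT.
rewrite ge0_integral_cV_cons//.
rewrite -[RHS](@integral_normal_pdf R 0 1).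
apply: eq_integral => a _.
transitivity (\int[mu n]_v ((normal_pdf 0 1 a)%:E * (gaussian_pdf 0 1%:M v)%:E)).
  apply: eq_integral => v _; rewrite -EFinM; congr _%:E.
  rewrite -gaussian_pdf_scalar1 -gaussian_pdf_col_mx; try exact: posdef_scalar1.
  by rewrite col_mx0 -scalar_mx_block.
rewrite (ge0_integralZl (mu n) measurableT (mE 0%R 1%:M)).
- by rewrite IH mule1.
- by move=> x _; exact: ge0.
- by rewrite lee_fin normal_pdf_ge0.
Qed.

(** Whitening: with [C = A A^T], the substitution [A x + m] leads to the standard density, a product
    of one-dimensional normal densities. *)
Lemma integral_gaussian_pdf n (m : 'cV[R]_n) C : sym_posdef C ->
  \int[mu n]_x (gaussian_pdf m C x)%:E = 1.
Proof.
move=> hC; have [A Au CE] := posdef_cholesky hC.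
have A0 : \det A != 0%R by rewrite -unitfE -unitmxE.
have h : \int[mu n]_x (gaussian_pdf m C (A *m x + m)%R)%:E = (`|\det A|^-1)%:E.
  transitivity (\int[mu n]_x ((`|\det A|^-1)%:E * (gaussian_pdf 0 1%:M x)%:E)).
    apply: eq_integral => x _; rewrite -EFinM mulrC.
    rewrite -(gaussian_pdf_affine m) ?mulmx0 ?add0r ?mulmx1 -?CE//.
    exact: posdef_scalar1.
  rewrite (ge0_integralZl (mu n) measurableT (mE 0%R 1%:M)).
  - by rewrite integral_gaussian_pdf_std mule1.
  - by move=> x _; exact: ge0.
  - by rewrite lee_fin invr_ge0.
move: h; rewrite (ge0_integral_cV_affine m (f := fun x => (gaussian_pdf m C x)%:E))//.
move=> /(congr1 (fun e => (`|\det A|)%:E * e)).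
by rewrite muleA -!EFinM divff ?normr_eq0// mul1e.
Qed.

End gaussian_pdf.

Section gaussian_vectors.
Context d (T : measurableType d) (R : realType) (P : probability T R).
Local Notation mu n := (@lebesgue_cV R n).
Local Open Scope ereal_scope.

Lemma gaussian_affine n (Z : T -> 'cV[R]_n) m C (A : 'M[R]_n) b :
  A \in unitmx -> sym_posdef C -> gaussian P Z m C ->
  gaussian P (fun w => A *m Z w + b)%R (A *m m + b)%R (A *m C *m A^T)%R.
Proof.
move=> Au hC [_ _ hZ]; split; [exact: measurable_gaussian_pdf|exact: gaussian_pdf_ge0|].
move=> S mS.
have A0 : \det A != 0%R by rewrite -unitfE -unitmxE.
have mS' : measurable ((fun x : 'cV[R]_n => A *m x + b)%R @^-1` S).
  by rewrite -[X in measurable X]setTI; exact: measurable_cV_affine.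
rewrite [LHS](hZ _ mS') integral_mkcond [RHS]integral_mkcond.
set h := (X in _ = \int[_]_x X x).
have mh : measurable_fun [set: 'cV[R]_n] h.
  apply: (measurable_restrictT _ mS).1; apply: measurable_funTS.
  exact: measurable_gaussian_pdf_EFin.
have h0 x : 0 <= h x by apply: erestrict_ge0 => y _; rewrite lee_fin gaussian_pdf_ge0.
transitivity (`|\det A|%:E * \int[mu n]_x h (A *m x + b)%R).
  rewrite -ge0_integralZl//; last first.
    exact: (measurableT_comp mh (measurable_cV_affine _ _)).
  apply: eq_integral => x _; rewrite /h !patchE.
  have -> : (x \in (fun x : 'cV[R]_n => A *m x + b)%R @^-1` S) =
    (A *m x + b \in S)%R by [].
  case: ifPn => _; last by rewrite mule0.
  by rewrite gaussian_pdf_affine// -EFinM mulrCA divff ?mulr1// normr_eq0.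
by rewrite ge0_integral_cV_affine// muleA -EFinM divff ?mul1e// normr_eq0.
Qed.

Lemma gaussian_col_mx k n (Z0 : {RV P >-> 'cV[R]_k}) (Z1 : {RV P >-> 'cV[R]_n})
    m0 C0 m1 C1 :
  sym_posdef C0 -> sym_posdef C1 -> independent_vectors P Z0 Z1 ->
  gaussian P Z0 m0 C0 -> gaussian P Z1 m1 C1 ->
  gaussian P (fun w => col_mx (Z0 w) (Z1 w)) (col_mx m0 m1) (block_mx C0 0 0 C1)%R.
Proof.
move=> hC0 hC1 indep [_ _ h0] [_ _ h1].
split; [exact: measurable_gaussian_pdf|exact: gaussian_pdf_ge0|move=> S mS].
pose col (p : 'cV[R]_k * 'cV[R]_n) := col_mx p.1 p.2.
have mZ : measurable_fun [set: T] (fun w => (Z0 w, Z1 w)).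
  by apply: measurable_fun_pair.
have mcol : measurable (col @^-1` S).
  by rewrite -[X in measurable X]setTI; exact: measurable_col_mx.
(* Independence identifies the joint law with the product law on rectangles; uniqueness of the
   product measure extends this to every measurable set. *)
have law : (distribution P Z0 \x distribution P Z1)%E (col @^-1` S) =
    pushforward P (fun w => (Z0 w, Z1 w)) (col @^-1` S).
  exact: product_measure_unique.
have -> : P ((fun w => col_mx (Z0 w) (Z1 w)) @^-1` S) =
    (distribution P Z0 \x distribution P Z1)%E (col @^-1` S) by rewrite law.
rewrite /product_measure1 /=.
rewrite (@ge0_integral_density _ _ _ (mu k) _ (gaussian_pdf m0 C0)); last 5 first.
- exact: measurable_gaussian_pdf.
- exact: gaussian_pdf_ge0.
- exact: h0.
- exact: measurable_fun_xsection.
- by move=> x; exact: measure_ge0.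
rewrite [RHS]integral_mkcond ge0_integral_cV_col_mx; last 2 first.
- apply: (measurable_restrictT _ mS).1; apply: measurable_funTS.
  exact: measurable_gaussian_pdf_EFin.
- by apply: erestrict_ge0 => y _; rewrite lee_fin gaussian_pdf_ge0.
apply: eq_integral => x _ /=.
have mx : measurable (xsection (col @^-1` S) x) by exact: measurable_xsection.
rewrite [X in X * _](h1 _ mx) integral_mkcond muleC -ge0_integralZl//; last 3 first.
- apply: (measurable_restrictT _ mx).1; apply: measurable_funTS.
  exact: measurable_gaussian_pdf_EFin.
- by move=> y _; apply: erestrict_ge0 => z _; rewrite lee_fin gaussian_pdf_ge0.
- by rewrite lee_fin gaussian_pdf_ge0.
apply: eq_integral => y _; rewrite !patchE mem_xsection.
have -> : ((x, y) \in col @^-1` S) = (col_mx x y \in S) by [].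
case: ifPn => _; last by rewrite mule0.
by rewrite -EFinM gaussian_pdf_col_mx.
Qed.

(** The joint density factors, and the factor in the lower coordinates integrates to 1. *)
Lemma gaussian_usubmx k n (Z : T -> 'cV[R]_(k + n)) m C0 C1 :
  sym_posdef C0 -> sym_posdef C1 -> gaussian P Z m (block_mx C0 0 0 C1)%R ->
  gaussian P (fun w => usubmx (Z w)) (usubmx m) C0.
Proof.
move=> hC0 hC1 [_ _ hZ].
split; [exact: measurable_gaussian_pdf|exact: gaussian_pdf_ge0|move=> S mS].
have mS' : measurable ((@usubmx _ k n 1) @^-1` S).
  rewrite -[X in measurable X]setTI (_ : usubmx = fun x : 'cV[R]_(k + n) =>
    row_mx 1%:M 0 *m x)%R; first exact: measurable_cV_linear.
  apply/funext => x; rewrite -{2}[x]vsubmxK mul_row_col mul1mx mul0mx.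
  by rewrite addr0.
rewrite [LHS](hZ _ mS') integral_mkcond [RHS]integral_mkcond.
rewrite ge0_integral_cV_col_mx; last 2 first.
- apply: (measurable_restrictT _ mS').1; apply: measurable_funTS.
  exact: measurable_gaussian_pdf_EFin.
- by apply: erestrict_ge0 => y _; rewrite lee_fin gaussian_pdf_ge0.
apply: eq_integral => x _.
transitivity (\int[mu n]_y ((EFin \o gaussian_pdf (usubmx m) C0) \_ S x *
    (gaussian_pdf (dsubmx m) C1 y)%:E)).
  apply: eq_integral => y _; rewrite !patchE.
  have -> : (col_mx x y \in (@usubmx _ k n 1) @^-1` S) = (x \in S).
    by rewrite -[in RHS](col_mxKu x y).
  case: ifPn => _; last by rewrite mul0e.
  by rewrite /= -[m]vsubmxK gaussian_pdf_col_mx// col_mxKu col_mxKd.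
rewrite ge0_integralZl//.
- by rewrite integral_gaussian_pdf// mule1.
- exact: measurable_gaussian_pdf_EFin.
- by move=> y _; rewrite lee_fin gaussian_pdf_ge0.
- by apply: erestrict_ge0 => y _; rewrite lee_fin gaussian_pdf_ge0.
Qed.

End gaussian_vectors.

(** * Entropy and mutual information *)

Section entropy_gaussian.
Context d (T : measurableType d) (R : realType) (P : probability T R).
Local Notation mu n := (@lebesgue_cV R n).
Local Open Scope ereal_scope.

(* The image is completed by rows spanning the kernel of [C A^T], so that the
   completed image has block diagonal covariance. *)
Lemma gaussian_row_free r n (Z : T -> 'cV[R]_n) m C (A : 'M[R]_(r, n)) :
  row_free A -> sym_posdef C -> gaussian P Z m C ->
  gaussian P (fun w => A *m Z w)%R (A *m m)%R (A *m C *m A^T)%R.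
Proof.
move=> Af hC hZ.
(* Writing [n] as [r + k] makes [A] stacked on [K] a square matrix, to which [gaussian_affine]
   applies. *)
have [k nE] : exists k, n = (r + k)%N.
  exists (n - r)%N; rewrite subnKC//; move/eqP: Af => <-; exact: rank_leq_col.
subst n.
have [K Kf KA] : exists2 K : 'M[R]_(k, r + k), row_free K & (K *m (C *m A^T) = 0)%R.
  apply: exists_ker_basis; rewrite -mxrank_tr trmx_mul trmxK hC.1.
  rewrite mxrankMfree; first exact/eqP.
  by rewrite row_free_unit posdef_unit.
have AK : (A *m C *m K^T = 0)%R.
  by have := congr1 trmx KA; rewrite !trmx_mul trmxK hC.1 trmx0.
have hA := posdef_congr hC Af; have hK := posdef_congr hC Kf.
pose M := col_mx A K.
have MM : (M *m C *m M^T = block_mx (A *m C *m A^T) 0 0 (K *m C *m K^T))%R.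
  by rewrite /M tr_col_mx mul_col_mx mul_col_row AK -(mulmxA K) KA.
have Mu : M \in unitmx.
  rewrite unitmxE unitfE; apply: contraTneq (posdef_det_gt0 (posdef_block_diag hA hK)).
  by move=> M0; rewrite -MM !det_mulmx M0 !mul0r ltxx.
have := gaussian_affine 0%R Mu hC hZ; rewrite MM.
move=> /(gaussian_usubmx hA hK).
under [X in gaussian P X]eq_fun do rewrite addr0 mul_col_mx col_mxKu.
by rewrite addr0 mul_col_mx col_mxKu.
Qed.

Lemma ge0_integral_is_density n (Z : T -> 'cV[R]_n) f (g : 'cV[R]_n -> \bar R) :
  measurable_fun [set: T] Z -> is_density P Z f ->
  measurable_fun [set: 'cV[R]_n] g -> (forall x, 0 <= g x) ->
  \int[P]_w g (Z w) = \int[mu n]_x (g x * (f x)%:E).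
Proof.
move=> mZ [mf f0 hf] mg g0.
rewrite -[LHS](@ge0_integral_pushforward _ _ _ _ _ _ mZ P setT g)//.
exact: ge0_integral_density.
Qed.

Lemma density_ae_eq n (Z : T -> 'cV[R]_n) f g :
  is_density P Z f -> is_density P Z g -> ae_eq (mu n) setT f g.
Proof.
move=> [mf f0 hf] [mg g0 hg].
have : ae_eq (mu n) setT (EFin \o f) (EFin \o g).
  apply: integral_ae_eq => //.
  - apply/integrableP; split; first exact/measurable_EFinP.
    under eq_integral do rewrite /= ger0_norm//.
    by rewrite -hf// probability_setT ltry.
  - exact/measurable_EFinP.
  - by move=> A _ mA; rewrite /= -hf// -hg.
by apply: filterS => x /= h xT; have [] := h xT.
Qed.

(** Any density may replace the chosen one: two densities differ on a Lebesgue-null set [N], and [Z]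
    falls in [N] with probability the integral of [f] over [N], that is 0. *)
Lemma entropyE n (Z : T -> 'cV[R]_n) f :
  measurable_fun [set: T] Z -> is_density P Z f ->
  entropy P Z = \int[P]_w (- ln (f (Z w)))%:E.
Proof.
move=> mZ hf; have hg : is_density P Z (density P Z) by exact: (xgetI _ hf).
have [mf f0 Pf] := hf; have [mg g0 Pg] := hg.
rewrite /entropy unlock.
have mlog (h : 'cV[R]_n -> R) : measurable_fun [set: 'cV[R]_n] h ->
    measurable_fun [set: T] (fun w => (- ln (h (Z w)))%:E).
  move=> mh; apply/measurable_EFinP; apply: measurableT_comp => //.
  apply: (measurableT_comp (@measurable_ln R)).
  exact: (measurableT_comp mh mZ).
apply: ae_eq_integral => //; [exact: mlog|exact: mlog|].
have [N [mN N0 sN]] := density_ae_eq hg hf.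
exists (Z @^-1` N); split.
- by rewrite -[X in measurable X]setTI; exact: mZ.
- transitivity (\int[mu n]_(x in N) (f x)%:E); first exact: Pf.
  rewrite null_set_integral//.
  by apply: measurable_funTS; exact/measurable_EFinP.
- move=> w /= h; apply: sN => /= fg; apply: h => _.
  by rewrite fg.
Qed.

(** The variance of the standard normal law, kept symbolic: it enters an entropy only through the
    constant per dimension that cancels in the mutual information. *)
Definition std_moment2 : \bar R :=
  \int[mu 1]_x (x 0%R 0%R ^+ 2 * gaussian_pdf 0 1%:M x)%:E.

Let mcoor2 : measurable_fun [set: 'cV[R]_1] (fun x => x 0 0 ^+ 2)%R.
Proof. by apply: measurable_funX; exact: measurable_cV_coor. Qed.

Lemma std_moment2_ge0 : 0 <= std_moment2.
Proof.
apply: integral_ge0 => x _; rewrite lee_fin mulr_ge0 ?sqr_ge0//.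
exact: gaussian_pdf_ge0.
Qed.

(* [x^2 / 4 <= exp (x^2 / 4)] bounds the integrand by a multiple of the
   density of variance [2]. *)
Lemma std_moment2_fin : std_moment2 \is a fin_num.
Proof.
rewrite ge0_fin_numE ?std_moment2_ge0//.
(* The 4 comes from [x^2 <= 4 exp (x^2 / 4)]; the quotient of roots exchanges the normalizing
   constants of variances 1 and 2. *)
pose K : R := (4 * Num.sqrt ((2 * pi) ^+ 1 * \det (2%:M : 'M[R]_1)) /
  Num.sqrt ((2 * pi) ^+ 1 * \det (1%:M : 'M[R]_1)))%R.
have h2 : sym_posdef (2%:M : 'M[R]_1).
  have := @posdef_diag R 1 (const_mx (2 : R)%R); rewrite diag_const_mx; apply => i.
  by rewrite mxE.
have K0 : (0 <= K)%R by rewrite divr_ge0 ?mulr_ge0 ?sqrtr_ge0.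
apply: (@le_lt_trans _ _ (\int[mu 1]_x (K%:E * (gaussian_pdf 0 2%:M x)%:E))); last first.
  rewrite (ge0_integralZl _ measurableT (measurable_gaussian_pdf_EFin _ _))//.
    by rewrite integral_gaussian_pdf// mule1 ltry.
  by move=> x _; rewrite lee_fin gaussian_pdf_ge0.
apply: ge0_le_integral => //.
- by move=> x _; rewrite lee_fin mulr_ge0 ?sqr_ge0 ?gaussian_pdf_ge0.
- apply/measurable_EFinP; apply: measurable_funM => //.
  exact: measurable_gaussian_pdf.
- by apply: measurable_funeM; exact: measurable_gaussian_pdf_EFin.
move=> x _; rewrite -EFinM lee_fin /gaussian_pdf /K.
have q c : ((x - 0)^T *m invmx c%:M *m (x - 0))%R 0%R 0%R = (x 0 0 ^+ 2 / c)%R.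
  rewrite subr0 invmx_scalar mul_mx_scalar -scalemxAl mxE mxE big_ord1 mxE.
  by rewrite mulrC expr2.
rewrite !q; set s1 := Num.sqrt _; set s2 := Num.sqrt _.
have s20 : s2 != 0%R.
  rewrite gt_eqF// sqrtr_gt0 mulr_gt0 ?posdef_det_gt0// expr1 mulr_gt0//.
  exact: pi_gt0.
have s10 : s1 != 0%R.
  rewrite gt_eqF// sqrtr_gt0 mulr_gt0 ?posdef_det_gt0// ?expr1 ?mulr_gt0//.
    exact: pi_gt0.
  exact: posdef_scalar1.
have -> : (4 * s2 / s1 * (expR (- (x 0 0 ^+ 2 / 2) / 2) / s2) =
    4 * expR (- (x 0 0 ^+ 2 / 2) / 2) / s1)%R.
  by move: (expR _) => e; field; rewrite s10 s20.
rewrite mulrA ler_wpM2r ?invr_ge0 ?sqrtr_ge0//.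
pose a := (x 0 0 ^+ 2 / 4)%R.
have -> : (x 0 0 ^+ 2 = 4 * a)%R by rewrite /a; field.
have -> : (- (4 * a / 1) / 2 = - a - a)%R by field.
have -> : (- (4 * a / 2) / 2 = - a)%R by field.
rewrite expRD -mulrA ler_wpM2l// mulrA ler_piMl ?expR_ge0//.
rewrite expRN ler_pdivrMr ?expR_gt0// mul1r.
by rewrite (le_trans _ (expR_ge1Dx a))// lerDr.
Qed.

(** After whitening, the quadratic form is the sum of the squared coordinates of a standard Gaussian
    vector, each of them a standard normal variable by [gaussian_row_free]. *)
Lemma gaussian_moment2 n (Z : T -> 'cV[R]_n) m C :
  measurable_fun [set: T] Z -> sym_posdef C -> gaussian P Z m C ->
  \int[P]_w (((Z w - m)^T *m invmx C *m (Z w - m)) 0 0)%R%:E =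
  n%:R%:E * std_moment2.
Proof.
move=> mZ hC hZ; have [A Au CE] := posdef_cholesky hC.
pose U w := (invmx A *m Z w - invmx A *m m)%R.
have hU : gaussian P U 0%R 1%:M%R.
  have := gaussian_affine (A := invmx A) (- (invmx A *m m))%R _ hC hZ.
  rewrite unitmx_inv => /(_ Au); rewrite subrr CE mulmxA mulVmx// mul1mx.
  by rewrite -trmx_mul mulVmx// trmx1.
have mU : measurable_fun [set: T] U.
  exact: (measurableT_comp (measurable_cV_affine (invmx A) _) mZ).
have UU w : (((Z w - m)^T *m invmx C *m (Z w - m)) 0 0 = \sum_i U w i 0 ^+ 2)%R.
  have -> : (Z w - m = A *m U w)%R by rewrite /U -mulmxBr mulKVmx.
  have -> : invmx C = (invmx A^T *m invmx A)%R.
    have Cu := posdef_unit hC; apply: (can_inj (mulKmx Cu)).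
    by rewrite mulmxV// CE !mulmxA mulmxK ?unitmx_tr// mulmxV.
  rewrite trmx_mul !mulmxA mulmxK ?unitmx_tr// mulmxKV// mxE.
  by apply: eq_bigr => i _; rewrite mxE expr2.
have mUi i : measurable_fun [set: T] (fun w => U w i 0 ^+ 2)%R.
  apply: measurable_funX; exact: (measurableT_comp (measurable_cV_coor i) mU).
under eq_integral do rewrite UU -sumEFin.
rewrite ge0_integral_sum//; last 2 first.
- by move=> i; exact/measurable_EFinP.
- by move=> i w _; rewrite lee_fin sqr_ge0.
transitivity (\sum_(i < n) std_moment2); last first.
  by rewrite -(fineK std_moment2_fin) sumEFin sumr_const card_ord -EFinM mulr_natl.
apply: eq_bigr => i _.
pose e : 'rV[R]_n := delta_mx 0%R i.
have ef : row_free e.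
  apply/row_freeP; exists e^T; rewrite trmx_delta mul_delta_mx.
  by apply/matrixP => a b; rewrite !ord1 !mxE.
have := gaussian_row_free ef (@posdef_scalar1 R n) hU.
rewrite mulmx0 mulmx1 trmx_delta mul_delta_mx.
have -> : delta_mx 0%R 0%R = 1%:M%R :> 'M[R]_1 by apply/matrixP => a b; rewrite !ord1 !mxE.
move=> hei.
have mei : measurable_fun [set: T] (fun w => e *m U w)%R.
  exact: (measurableT_comp (measurable_cV_linear e) mU).
rewrite /std_moment2; under [RHS]eq_integral do rewrite EFinM.
rewrite -(ge0_integral_is_density mei hei (g := fun y => (y 0 0 ^+ 2)%R%:E)).
- by apply: eq_integral => w _; rewrite -rowE [in RHS]mxE.
- exact/measurable_EFinP.
- by move=> y; rewrite lee_fin sqr_ge0.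
Qed.

(** The constant [c] of the overview: the entropy of a standard normal variable, classically
    [ln (2 pi e) / 2]. *)
Definition entropy_unit : R := ((ln (2 * pi) + fine std_moment2) / 2)%R.

Lemma entropy_gaussian n (Z : T -> 'cV[R]_n) m C :
  measurable_fun [set: T] Z -> sym_posdef C -> gaussian P Z m C ->
  entropy P Z = (n%:R * entropy_unit + ln (\det C) / 2)%:E.
Proof.
move=> mZ hC hZ; rewrite (entropyE mZ hZ).
pose Q w := (((Z w - m)^T *m invmx C *m (Z w - m)) 0 0)%R.
(* The logarithm of the normalizing constant: minus the log-density is [Q / 2 + K], so only the mean
   of [Q] has to be computed. *)
pose K : R := ((n%:R * ln (2 * pi) + ln (\det C)) / 2)%R.
have dC := posdef_det_gt0 hC.
have pi2 : (0 < 2 * pi :> R)%R by rewrite mulr_gt0// pi_gt0.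
have KE : ln (Num.sqrt ((2 * pi) ^+ n * \det C)) = K.
  have lnK2 : (expR K ^+ 2 = (2 * pi) ^+ n * \det C)%R.
    rewrite expr2 -expRD /K -splitr expRD lnK ?posrE// mulr_natl.
    by rewrite -lnXn// lnK// posrE exprn_gt0.
  by rewrite -lnK2 sqrtr_sqr gtr0_norm ?expR_gt0// expRK.
have logE w : (- ln (gaussian_pdf m C (Z w)) = 2^-1 * Q w + K)%R.
  rewrite /gaussian_pdf ln_div ?posrE ?expR_gt0 ?sqrtr_gt0 ?mulr_gt0 ?exprn_gt0//.
  by rewrite expRK KE /Q opprB mulNr opprK addrC mulrC.
have mQ : measurable_fun [set: T] Q.
  apply: (measurableT_comp (measurable_quad_form (invmx C))).
  exact: (measurableT_comp (measurable_cV_shift (- m)%R) mZ).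
have Q0 w : (0 <= Q w)%R.
  have [z0|z0] := eqVneq (Z w - m)%R 0%R; first by rewrite /Q z0 mulmx0 mxE.
  have iC : sym_posdef (invmx C) by exact: posdef_inv.
  by rewrite ltW// iC.2.
have iQ : \int[P]_w (2^-1 * Q w)%:E = (2^-1 * (n%:R * fine std_moment2))%:E.
  under eq_integral do rewrite EFinM.
  rewrite ge0_integralZl//.
  - by rewrite gaussian_moment2// !EFinM fineK// std_moment2_fin.
  - exact/measurable_EFinP.
  - by move=> w _; rewrite lee_fin.
have mQ2 : measurable_fun [set: T] (fun w => 2^-1 * Q w)%R by exact: measurable_funM.
under eq_integral do rewrite logE EFinD.
rewrite integralD//.
- rewrite iQ integral_cst//= probability_setT mule1 -EFinD; congr _%:E.
  by rewrite /entropy_unit /K; field.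
- apply/integrableP; split; first exact/measurable_EFinP.
  under eq_integral do rewrite /= ger0_norm ?mulr_ge0//.
  by rewrite iQ ltry.
- exact: finite_measure_integrable_cst.
Qed.

End entropy_gaussian.

Section mutual_information_gaussian.
Context d (T : measurableType d) (R : realType) (P : probability T R).

Lemma mutual_information_linear n q r (B : 'M[R]_(n, q)) mX CX mE CE
    (X : {RV P >-> 'cV[R]_q}) (E : {RV P >-> 'cV[R]_n}) (V : 'M[R]_(n, r)) :
  sym_posdef CX -> sym_posdef CE -> gaussian P X mX CX -> gaussian P E mE CE ->
  independent_vectors P X E -> row_free V^T ->
  mutual_information P (fun w => V^T *m (B *m X w + E w)) X =
  (ln (\det (V^T *m (B *m CX *m B^T + CE) *m V) / \det (V^T *m CE *m V)) / 2)%:E.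
Proof.
move=> hCX hCE hX hE hXE Vf.
have hEX : independent_vectors P E X.
  by move=> S S' mS mS'; rewrite setIC muleC hXE.
have hT := gaussian_col_mx hCE hCX hEX hE hX.
have hCT := posdef_block_diag hCE hCX.
pose Z w := col_mx (E w) (X w).
have mZ : measurable_fun [set: T] Z.
  have mEX : measurable_fun [set: T] (fun w => (E w, X w)).
    exact: measurable_fun_pair.
  exact: (measurableT_comp (@measurable_col_mx R n q) mEX).
have [Vr VVr] := row_freeP Vf.
pose F := row_mx V^T (V^T *m B) : 'M[R]_(r, n + q).
have Ff : row_free F.
  by apply/row_freeP; exists (col_mx Vr 0); rewrite mul_row_col mulmx0 addr0.
have FZ w : F *m Z w = V^T *m (B *m X w + E w).
  by rewrite mul_row_col mulmxDr mulmxA addrC.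
pose G := block_mx V^T (V^T *m B) 0 1%:M : 'M[R]_(r + q, n + q).
have Gf : row_free G.
  apply/row_freeP; exists (block_mx Vr (- B) 0 1%:M).
  rewrite mulmx_block !mulmx0 !mul0mx !addr0 !add0r !mulmx1 VVr mulmxN addNr.
  by rewrite -scalar_mx_block.
have GZ w : G *m Z w = col_mx (V^T *m (B *m X w + E w)) (X w).
  by rewrite mul_block_col mul0mx add0r mul1mx mulmxDr mulmxA addrC.
have hF := gaussian_row_free Ff hCT hT; have hG := gaussian_row_free Gf hCT hT.
have pF := posdef_congr hCT Ff; have pG := posdef_congr hCT Gf.
have FC : F *m block_mx CE 0 0 CX *m F^T =
    V^T *m (B *m CX *m B^T + CE) *m V.
  rewrite mul_row_block !mulmx0 addr0 add0r tr_row_mx mul_row_col trmxK.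
  by rewrite trmx_mul trmxK mulmxDr mulmxDl !mulmxA addrC.
have detG : \det (G *m block_mx CE 0 0 CX *m G^T) =
    \det (V^T *m CE *m V) * \det CX.
  (* Splitting off the unipotent factor [S], of determinant 1, removes [B] from the joint
     determinant. *)
  pose S := block_mx 1%:M (V^T *m B) 0 1%:M : 'M[R]_(r + q).
  have GS : G = S *m block_mx V^T 0 0 1%:M.
    by rewrite mulmx_block !mulmx0 !mul0mx !mul1mx !mulmx1 !addr0 !add0r.
  have -> : G *m block_mx CE 0 0 CX *m G^T =
      S *m block_mx (V^T *m CE *m V) 0 0 CX *m S^T.
    rewrite GS trmx_mul !mulmxA -(mulmxA S) -(mulmxA S); congr (_ *m _ *m _).
    rewrite tr_block_mx !mulmx_block !trmx0 trmx1 trmxK.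
    by rewrite !(mulmx0, mul0mx, mulmx1, mul1mx, addr0, add0r).
  rewrite !det_mulmx det_tr det_ublock !det1 det_ublock.
  by rewrite !mul1r mulr1.
rewrite /mutual_information.
have mlin k (A : 'M[R]_(k, n + q)) : measurable_fun [set: T] (fun w => A *m Z w).
  exact: (measurableT_comp (measurable_cV_linear A) mZ).
have -> : (fun w => V^T *m (B *m X w + E w)) = (fun w => F *m Z w).
  by apply/funext => w; rewrite FZ.
have -> : (fun w => col_mx (V^T *m (B *m X w + E w)) (X w)) =
    (fun w => G *m Z w) by apply/funext => w; rewrite GZ.
rewrite (entropy_gaussian (mlin _ F) pF hF) (entropy_gaussian (mlin _ G) pG hG).
rewrite (entropy_gaussian _ hCX hX)// detG FC -EFinD; congr _%:E.
have dX := posdef_det_gt0 hCX.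
have dE : 0 < \det (V^T *m CE *m V).
  by have := posdef_det_gt0 (posdef_congr hCE Vf); rewrite trmxK.
have dY : 0 < \det (V^T *m (B *m CX *m B^T + CE) *m V).
  by rewrite -FC posdef_det_gt0.
by rewrite lnM ?posrE// ln_div ?posrE// natrD; field.
Qed.

End mutual_information_gaussian.

Lemma ln_prod (R : realType) (I : finType) (A : pred I) (F : I -> R) :
  (forall i, 0 < F i) -> ln (\prod_(i | A i) F i) = \sum_(i | A i) ln (F i).
Proof.
move=> F0; suff [] : ln (\prod_(i | A i) F i) = \sum_(i | A i) ln (F i) /\
  0 < \prod_(i | A i) F i by [].
elim/big_ind2 : _ => [|x y x' y' [e x0] [e' x0']|i _] //; first by rewrite ln1.
by rewrite mulr_gt0// lnM ?posrE// e e'.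
Qed.

(** * Extremal determinant ratios and the relative error *)

Section rayleigh_max.
Context {R : realType} {n : nat}.
Variables (A C : 'M[R]_n) (lam : 'I_n -> R) (U : 'M[R]_n).
Hypotheses (hA : sym_posdef A) (lam_dec : forall i j : 'I_n, (i <= j)%N -> lam j <= lam i).
Hypotheses (UC : U *m C *m U^T = 1%:M) (UA : U *m A *m U^T = diag_mx (\row_i lam i)).

Let Uu : U \in unitmx.
Proof.
by have := unitmx1 R n; rewrite -UC -mulmxA unitmx_mul => /andP[].
Qed.

Lemma gen_eigenvalues_gt0 i : 0 < lam i.
Proof.
have := posdef_congr hA (A := U); rewrite row_free_unit => /(_ Uu).
rewrite UA => -[_ /(_ (delta_mx i 0))]; rewrite trmx_delta -rowE -colE.
rewrite !mxE eqxx mulr1n; apply.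
by apply/eqP => /matrixP/(_ i 0); rewrite !mxE !eqxx => /eqP; rewrite oner_eq0.
Qed.

(** In the coordinates [S = V^T U^-1] the pair [A], [C] becomes the diagonal matrix of [lam] and the
    identity, the setting of [det_compression_le]. *)
Lemma det_ratio_le r (V : 'M[R]_(n, r)) : row_free V^T ->
  \det (V^T *m A *m V) <=
  \prod_(i < n | (i < r)%N) lam i * \det (V^T *m C *m V).
Proof.
move=> Vf; pose S := V^T *m invmx U.
have SV : V^T = S *m U by rewrite mulmxKV.
have VS : V = U^T *m S^T by rewrite -trmx_mul -SV trmxK.
have E M : V^T *m M *m V = S *m (U *m M *m U^T) *m S^T.
  by rewrite SV {1}VS !mulmxA.
rewrite !E UC UA mulmx1; apply: det_compression_le => //.
  exact: gen_eigenvalues_gt0.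
by rewrite /row_free mxrankMfree ?row_free_unit ?unitmx_inv.
Qed.

Lemma det_ratio_attained r : (r <= n)%N ->
  exists2 V : 'M[R]_(n, r), \rank V = r &
    \det (V^T *m A *m V) = \prod_(i < n | (i < r)%N) lam i /\
    \det (V^T *m C *m V) = 1.
Proof.
(* [F U] consists of the first [r] rows of [U], the eigenvectors for the [r] largest eigenvalues. *)
move=> rn; pose F : 'M[R]_(r, n) := pid_mx r.
have Ff : row_free F.
  by rewrite /row_free rank_pid_mx.
have E M : (F *m U)^T^T *m M *m (F *m U)^T = F *m (U *m M *m U^T) *m F^T.
  by rewrite trmxK trmx_mul !mulmxA.
exists (F *m U)^T.
  by rewrite mxrank_tr mxrankMfree ?row_free_unit//; exact/eqP.
rewrite !E UC UA mulmx1; split.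
  have -> : F *m diag_mx (\row_i lam i) *m F^T =
      diag_mx (\row_(i < r) lam (widen_ord rn i)).
    apply/matrixP => i j; rewrite mul_mx_diag !mxE (bigD1 (widen_ord rn i))//=.
    rewrite big1 ?addr0; last first.
      move=> k ki; rewrite !mxE; have -> : (i == k :> nat) = false.
        by apply: contra_neqF ki => /eqP ik; apply/val_inj.
      by rewrite !mul0r.
    by rewrite !mxE/= eqxx !ltn_ord !andbT mul1r mulr_natr eq_sym -val_eqE.
  rewrite det_diag big_ord_narrow; apply: eq_bigr => i _; by rewrite mxE.
by rewrite tr_pid_mx mul_pid_mx minnn (minn_idPr rn) pid_mx_1 det1.
Qed.

End rayleigh_max.

Theorem corollary3p7 (R : realType) (d : measure_display) (T : measurableType d)
    (P : probability T R) (n q r : nat) (B : 'M[R]_(n, q))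
    (mX : 'cV[R]_q) (CX : 'M[R]_q) (mE : 'cV[R]_n) (CE : 'M[R]_n)
    (X : {RV P >-> 'cV[R]_q}) (E : {RV P >-> 'cV[R]_n})
    (Y : T -> 'cV[R]_n) (W : T -> 'cV[R]_r) (V : 'M[R]_(n, r))
    (CY : 'M[R]_n) (lam : 'I_n -> R)
    (hCX : sym_posdef CX) (hCE : sym_posdef CE)
    (hX : gaussian P X mX CX) (hE : gaussian P E mE CE)
    (hXE : independent_vectors P X E)
    (hY : forall w, Y w = B *m X w + E w)
    (hCY : CY = B *m CX *m B^T + CE)
    (hr : (1 <= r <= n)%N)
    (hV : max_information P Y X V)
    (hW : forall w, W w = V^T *m Y w)
    (hlam : gen_eigenvalues CY CE lam)
    (hI : mutual_information P Y X <> 0%E) :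
  ((mutual_information P Y X - mutual_information P W X) /
     mutual_information P Y X)%E =
  (1 - (\sum_(i < n | (i < r)%N) ln (lam i)) / (\sum_(i < n) ln (lam i)))%:E.
Proof.
have /andP[_ rn] := hr.
have hCY' : sym_posdef CY.
  split=> [|x x0].
    by rewrite hCY linearD/= !trmx_mul trmxK hCX.1 hCE.1 mulmxA.
  rewrite hCY mulmxDr mulmxDl mxE addrC ltr_wpDr ?hCE.2//.
  rewrite -[x^T *m _ *m x](_ : (B^T *m x)^T *m CX *m (B^T *m x) = _); last first.
    by rewrite trmx_mul trmxK !mulmxA.
  have [->|y0] := eqVneq (B^T *m x) 0; first by rewrite mulmx0 mxE.
  by rewrite ltW// hCX.2.
have [lam_dec _] := hlam.
have [U UC UY] := gen_eigenbasis hCY'.1 hCE hlam.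
have lam0 := gen_eigenvalues_gt0 hCY' UC UY.
have MI k (V' : 'M[R]_(n, k)) : row_free V'^T ->
    mutual_information P (fun w => V'^T *m Y w) X =
    (ln (\det (V'^T *m CY *m V') / \det (V'^T *m CE *m V')) / 2)%:E.
  move=> V'f; rewrite hCY -(mutual_information_linear B hCX hCE hX hE hXE V'f).
  by congr mutual_information; apply/funext => w; rewrite hY.
have free k (V' : 'M[R]_(n, k)) : (k <= n)%N -> full_rank V' -> row_free V'^T.
  by move=> kn rV'; rewrite /row_free mxrank_tr rV' (minn_idPr kn).
have IW : mutual_information P W X =
    ((\sum_(i < n | (i < r)%N) ln (lam i)) / 2)%:E.
  have [Vfull Vmax] := hV.
  have Vf := free _ _ rn Vfull.
  rewrite (_ : W = fun w => V^T *m Y w); last exact/funext.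
  (* Maximality of [V] against [V0] bounds its information from below; [det_ratio_le] applied to [V]
     gives the reverse bound. *)
  have [V0 rV0 [V0Y V0E]] := det_ratio_attained UC UY rn.
  have V0full : full_rank V0 by rewrite /full_rank rV0 (minn_idPr rn).
  have := Vmax _ V0full; rewrite !MI//; last exact: free.
  rewrite V0Y V0E divr1 lee_fin ler_pM2r ?invr_gt0// => le1.
  congr (_ / 2)%:E; apply/eqP; rewrite -ln_prod// eq_le le1 andbT.
  have dE : 0 < \det (V^T *m CE *m V).
    by have := posdef_det_gt0 (posdef_congr hCE Vf); rewrite trmxK.
  have dY : 0 < \det (V^T *m CY *m V).
    by have := posdef_det_gt0 (posdef_congr hCY' Vf); rewrite trmxK.
  rewrite ler_ln ?posrE ?divr_gt0// ?prodr_gt0// ler_pdivrMr//.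
  exact: det_ratio_le UC UY _ _ Vf.
have IY : mutual_information P Y X = ((\sum_(i < n) ln (lam i)) / 2)%:E.
  rewrite (_ : Y = fun w => (1%:M : 'M[R]_n)^T *m Y w); last first.
    by apply/funext => w; rewrite trmx1 mul1mx.
  rewrite MI; last by rewrite trmx1 row_free_unit unitmx1.
  rewrite trmx1 !mul1mx !mulmx1 -ln_prod//; congr (ln _ / 2)%:E.
  have dE := posdef_det_gt0 hCE.
  (* Taking determinants in both diagonalizations and dividing eliminates [\det U ^+ 2], leaving
     [\det CY / \det CE] as the product of all [lam i]. *)
  have := congr1 determinant UC; rewrite !det_mulmx det1 => dUC.
  have := congr1 determinant UY; rewrite !det_mulmx det_diag.
  under eq_bigr do rewrite mxE.
  move=> <-; apply: (mulIf (lt0r_neq0 dE)).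
  rewrite divfK ?gt_eqF//.
  transitivity (\det CY * (\det U * \det CE * \det U^T)); first by rewrite dUC mulr1.
  by ring.
(* The nonzero denominator turns the division in [\bar R] into a division of reals, where the
   factors 1/2 cancel. *)
have S0 : \sum_(i < n) ln (lam i) != 0.
  by apply/eqP => S0; apply: hI; rewrite IY S0 mul0r.
rewrite IY IW -EFinB inver mulf_eq0 (negbTE S0) invr_eq0 pnatr_eq0 /= -EFinM.
by congr _%:E; field.
Qed.
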